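(* Let $\{\alpha_n\}_{n\in\mathbb{N}}\subset(0,d)$ be such that $\alpha_n\to d^-$ as $n\to+\infty$. Let $u^\infty_0\in L^2(\Omega)$ and $\{u^n_0\}_{n\in\mathbb{N}}\subset L^2(\Omega)$ be such that $u^n_0\to u^\infty_0$ in $L^2(\Omega)$. Let $T>0$. Then, for each choice of sign $\sigma\in\{+1,-1\}$ the following holds. For every $n\in\mathbb{N}$ there exists a unique solution $u^n\in H^1([0,T];L^2(\Omega))$ of $$\begin{cases}u_t(t)=\sigma(-\Delta)^{-\frac{\alpha_n}{2}}u(t)&\text{for a.e. }t\in(0,T),\\ u(0)=u^n_0.\end{cases}$$ Moreover, $u^n\to u^\infty$ (strongly) in $H^1([0,T];L^2(\Omega))$ as $n\to+\infty$, where $u^\infty$ is the unique solution of $$\begin{cases}u_t(t)=2\sigma\displaystyle\int_\Omega u(t)\,dy&\text{for a.e. }t\in(0,T),\\ u(0)=u^\infty_0,\end{cases}$$ and, for every $t\in[0,T]$, $$\|u^n(t)-u^\infty(t)\|_{L^2(\Omega)}\to0\qquad\text{and}\qquad\mathcal{J}^{\alpha_n}(u^n(t))\to\mathcal{J}^d(u^\infty(t)).$$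
   Context: Let $d\in\mathbb{N}$ (with $d\ge 1$) and let $\Omega\subset\mathbb{R}^d$ be a bounded open set with Lipschitz continuous boundary. $L^2(\Omega)$ is the space of real-valued square-integrable functions. For $\alpha\in(0,d)$ and $u\in L^2(\Omega)$ set $$\mathcal{J}^\alpha(u):=-\int_\Omega\int_\Omega\frac{u(x)u(y)}{|x-y|^{d-\alpha}}\,dy\,dx,\qquad \mathcal{J}^d(u):=-\Big(\int_\Omega u(x)\,dx\Big)^2,$$ and define the $\alpha$-Riesz potential of $u$ (extended by $0$ outside $\Omega$) by $$(-\Delta)^{-\frac\alpha2}u(x):=2\int_{\Omega}\frac{u(y)}{|x-y|^{d-\alpha}}\,dy,$$ whose restriction to $\Omega$ belongs to $L^2(\Omega)$. The evolution equations are equalities in $L^2(\Omega)$; in the limit equation the right-hand side is the function on $\Omega$ that is constant in space, equal to $2\sigma$ times the integral of $u(t)$ over $\Omega$. Solutions are sought in $H^1([0,T];L^2(\Omega))$, the Sobolev space of $L^2(\Omega)$-valued functions of time, whose elements are identified with their continuous representatives. *)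

(* Defs.v *)
From HB Require Import structures.
From mathcomp Require Import all_boot all_order all_algebra.
From mathcomp Require Import all_classical all_reals all_analysis.
From mathcomp Require Import measurable_realfun.

Set Implicit Arguments.
Unset Strict Implicit.
Unset Printing Implicit Defensive.

Import Order.TTheory GRing.Theory Num.Theory.
Import numFieldNormedType.Exports.

Local Open Scope classical_set_scope.
Local Open Scope ring_scope.

Definition rV_display : measure_display.
Proof. exact: default_measure_display. Qed.

Section borel_rV.
Variables (R : realType) (d : nat).

Let borel : set (set 'rV[R]_d) := <<s open >>.

Let borelC (A : set 'rV[R]_d) : borel A -> borel (~` A).
Proof. exact: sigma_algebraC. Qed.

HB.instance Definition _ := @isMeasurable.Build
  rV_display 'rV[R]_d borel
  (@sigma_algebra0 _ setT open) borelC (@sigma_algebra_bigcup _ setT open).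

Lemma open_measurable_rV (U : set 'rV[R]_d) : open U -> measurable U.
Proof. exact: sub_sigma_algebra. Qed.

Lemma open_bigcup_ball_rV (U : set 'rV[R]_d) : open U ->
  U = \bigcup_(qk in [set qk : 'rV[rat]_d * nat |
        ball (map_mx ratr qk.1 : 'rV[R]_d) qk.2.+1%:R^-1 `<=` U])
        ball (map_mx ratr qk.1 : 'rV[R]_d) qk.2.+1%:R^-1.
Proof.
move=> oU; apply/seteqP; split => [x Ux|x [qk /= sub]]; last exact: sub.
have /nbhs_ballP[e /= e0 xeU] : nbhs x U by apply: open_nbhs_nbhs.
have [k ke] : exists k : nat, k.+1%:R^-1 < e / 2.
  near \oo => k; exists k; near: k; apply: near_infty_natSinv_lt (PosNum _).
  by rewrite divr_gt0.
have k0 : 0 < k.+1%:R^-1 :> R by rewrite invr_gt0.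
have /choice[q qx] : forall j, exists q : rat, ball (x ord0 j) k.+1%:R^-1 (ratr q).
  move=> j; have b0 : ball (x ord0 j) k.+1%:R^-1 !=set0.
    by exists (x ord0 j); exact: ballxx.
  have [r [xr [q _ qr]]] := @dense_rat R _ b0 (ball_open (x ord0 j : R^o) _).
  by exists q; rewrite qr.
exists (\row_j q j, k) => /=; last first.
  by split=> // i j; rewrite !mxE ord1; apply: ball_sym.
move=> y [_ qy]; apply: xeU; apply: (@le_ball _ _ x (e / 2 + e / 2)).
  by rewrite -splitr.
apply: (@ball_triangle R _ (map_mx ratr (\row_j q j) : 'rV[R]_d) x y (e / 2) (e / 2)).
  by split=> [|i j]; [rewrite divr_gt0|rewrite !mxE ord1; exact: le_ball (ltW ke) _ (qx j)].
split=> [|i j]; first by rewrite divr_gt0.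
exact: le_ball (ltW ke) _ (qy i j).
Unshelve. all: end_near. Qed.

Lemma measurable_fun_rV d' (T : measurableType d') (f : T -> 'rV[R]_d) :
  (forall j, measurable_fun setT (fun x => f x ord0 j)) -> measurable_fun setT f.
Proof.
move=> mf; apply: (@measurability _ _ _ _ _ _ (@open 'rV[R]_d)) => //.
move=> _ [U oU <-]; rewrite setTI (open_bigcup_ball_rV oU) preimage_bigcup.
rewrite bigcup_mkcond; apply: countable_bigcupT_measurable.
  exact/countableP.
move=> [q k]; case: ifPn => // _.
have -> : f @^-1` ball (map_mx ratr q : 'rV[R]_d) k.+1%:R^-1 =
    \bigcap_(j in [set: 'I_d])
      ((fun x => f x ord0 j) @^-1` ball (ratr (q ord0 j) : R) k.+1%:R^-1).
  apply/seteqP; split => [x [_ /= fx] j _ /=|x /= fx].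
    by have := fx ord0 j; rewrite mxE.
  split; first by rewrite invr_gt0.
  by move=> i j; rewrite ord1 mxE; exact: fx.
apply: fin_bigcap_measurable => // j _.
rewrite -[X in measurable X]setTI; apply: mf => //.
exact: measurable_ball.
Qed.

Lemma continuous_measurable_rV (f : 'rV[R]_d -> R) :
  continuous f -> measurable_fun setT f.
Proof.
move=> cf; apply: (measurability _ (RGenOpens.measurableE R)).
move=> _ [_ [x [y ->]] <-]; rewrite setTI; apply: open_measurable_rV.
by move/continuousP: cf; apply; exact: interval_open.
Qed.

End borel_rV.

(* The Lebesgue measure on R^n is the iterated product of the one on R, carried
   from R * R^n to R^n.+1 by [rV_cons]; see [lebesgue_rV_box]. *)
Section lebesgue_rV.
Variable R : realType.

Definition rV_cons n (p : R * 'rV[R]_n) : 'rV[R]_n.+1 := row_mx p.1%:M p.2.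

Definition rV_uncons n (x : 'rV[R]_n.+1) : R * 'rV[R]_n :=
  (x ord0 ord0, rsubmx (x : 'rV[R]_(1 + n))).

Lemma rV_consK n : cancel (@rV_cons n) (@rV_uncons n).
Proof.
move=> [a v]; rewrite /rV_uncons /rV_cons row_mxKr /=; congr (_, _).
transitivity ((row_mx a%:M v : 'rV[R]_(1 + n)) ord0 (lshift n ord0)).
  by congr (fun_of_matrix _ _ _); exact/val_inj.
by rewrite row_mxEl mxE.
Qed.

Lemma measurable_rV_cons n : measurable_fun setT (@rV_cons n).
Proof.
apply: measurable_fun_rV => j; case: (@split_ordP 1 n j) => k ->.
  rewrite (_ : (fun x => _) = fst) //; apply/funext => x.
  by rewrite [LHS](row_mxEl (x.1%:M : 'M[R]_1) x.2) mxE !ord1.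
rewrite (_ : (fun x => _) = (fun v : 'rV[R]_n => v ord0 k) \o snd); last first.
  by apply/funext => x; exact: (row_mxEr (x.1%:M : 'M[R]_1) x.2).
apply: measurableT_comp => //.
by apply: continuous_measurable_rV; exact: coord_continuous.
Qed.

Lemma measurable_rV_uncons n : measurable_fun setT (@rV_uncons n).
Proof.
apply: measurable_fun_pair.
  by apply: continuous_measurable_rV; exact: coord_continuous.
apply: measurable_fun_rV => j; under eq_fun do rewrite mxE.
by apply: continuous_measurable_rV; exact: coord_continuous.
Qed.

Section lebesgue_rV_step.
Variables (n : nat) (m : {sigma_finite_measure set 'rV[R]_n -> \bar R}).

Let prod : {measure set (measurableTypeR R * 'rV[R]_n)%type -> \bar R} :=
  (@lebesgue_measure R \x m)%E.

Definition lebesgue_rV_step : set 'rV[R]_n.+1 -> \bar R :=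
  pushforward prod (@rV_cons n).

Let pf : {measure set 'rV[R]_n.+1 -> \bar R} :=
  measure_function_pushforward__canonical__measure_function_Measure prod
    (@measurable_rV_cons n).

Let step0 : lebesgue_rV_step set0 = 0%E.
Proof. exact: (measure0 pf). Qed.

Let step_ge0 A : (0 <= lebesgue_rV_step A)%E.
Proof. exact: (measure_ge0 pf). Qed.

Let step_sigma_additive : semi_sigma_additive lebesgue_rV_step.
Proof. exact: (@measure_semi_sigma_additive _ _ _ pf). Qed.

HB.instance Definition _ := isMeasure.Build _ _ _ lebesgue_rV_step
  step0 step_ge0 step_sigma_additive.

Let step_sigma_finite : sigma_finite setT lebesgue_rV_step.
Proof.
have /sigma_finiteP[F [FT ndF Foo]] := sigma_finiteT (@lebesgue_measure R).
have /sigma_finiteP[G [GT ndG Goo]] := sigma_finiteT m.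
exists (fun k => @rV_uncons n @^-1` (F k `*` G k)).
  rewrite -preimage_bigcup (_ : \bigcup_k _ = setT) ?preimage_setT//.
  apply/seteqP; split => // -[x v] _.
  have [i _ Fi] : (\bigcup_i F i) x by rewrite -FT.
  have [j _ Gj] : (\bigcup_j G j) v by rewrite -GT.
  exists (maxn i j) => //; split => /=.
    by move: x Fi; exact/subsetPset/ndF/leq_maxl.
  by move: v Gj; exact/subsetPset/ndG/leq_maxr.
move=> k; have [mF Fk] := Foo k; have [mG Gk] := Goo k; split.
  rewrite -[X in measurable X]setTI; apply: measurable_rV_uncons => //.
  exact: measurableX.
rewrite /lebesgue_rV_step /pushforward -comp_preimage.
rewrite (_ : _ \o _ = id); last by apply/funext => p; exact: rV_consK.
by rewrite preimage_id /= product_measure1E// lte_mul_pinfty// ge0_fin_numE.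
Qed.

HB.instance Definition _ := Measure_isSigmaFinite.Build _ _ _ lebesgue_rV_step
  step_sigma_finite.

End lebesgue_rV_step.

Fixpoint lebesgue_rV n : {sigma_finite_measure set 'rV[R]_n -> \bar R} :=
  match n with
  | 0 => \d_(0 : 'rV[R]_0)
  | n'.+1 => lebesgue_rV_step (lebesgue_rV n')
  end.

Definition rV_box n (a b : 'rV[R]_n) :=
  [set x : 'rV[R]_n | forall i, x ord0 i \in `[a ord0 i, b ord0 i]].

Lemma measurable_rV_box n (a b : 'rV[R]_n) : measurable (rV_box a b).
Proof.
rewrite (_ : rV_box a b = \bigcap_(i in [set: 'I_n])
    ((fun x : 'rV[R]_n => x ord0 i) @^-1` `[a ord0 i, b ord0 i])); last first.
  by apply/seteqP; split => [x ab i _|x ab i]; [exact: ab|exact: (ab i I)].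
apply: fin_bigcap_measurable => // i _; rewrite -[X in measurable X]setTI.
have := @continuous_measurable_rV R n (fun x => x ord0 i).
by apply => //; exact: coord_continuous.
Qed.

Lemma lebesgue_rV_box n (a b : 'rV[R]_n) :
  (forall i, a ord0 i <= b ord0 i) ->
  lebesgue_rV n (rV_box a b) = (\prod_i (b ord0 i - a ord0 i))%:E.
Proof.
elim: n a b => [|n IH] a b ab.
  by rewrite /= diracE big_ord0 mem_set// => -[].
rewrite -[LHS]/((@lebesgue_measure R \x lebesgue_rV n)%E (@rV_cons n @^-1` rV_box a b)).
set a' := rsubmx (a : 'rV[R]_(1 + n)); set b' := rsubmx (b : 'rV[R]_(1 + n)).
have consE (p : R * 'rV[R]_n) : rV_cons p ord0 ord0 = p.1.
  by have /(congr1 fst) := rV_consK p.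
have shift (c : 'rV[R]_n.+1) i :
    rsubmx (c : 'rV[R]_(1 + n)) ord0 i = c ord0 (lift ord0 i).
  by rewrite mxE; congr (fun_of_matrix _ _ _); exact/val_inj.
have consS (p : R * 'rV[R]_n) i : rV_cons p ord0 (lift ord0 i) = p.2 ord0 i.
  transitivity ((rV_uncons (rV_cons p)).2 ord0 i); last by rewrite rV_consK.
  exact/esym/shift.
rewrite (_ : _ @^-1` _ = `[a ord0 ord0, b ord0 ord0]%classic `*` rV_box a' b').
  rewrite product_measure1E//; last exact: measurable_rV_box.
  rewrite IH => [|i]; last by rewrite !shift.
  rewrite [X in (X * _)%E](lebesgue_measure_itv `[a ord0 ord0, b ord0 ord0])/=.
  rewrite lte_fin big_ord_recl.
  under eq_bigr do rewrite !shift.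
  have := ab ord0; rewrite le_eqVlt => /predU1P[->|->]; last first.
    by rewrite -EFinB -EFinM.
  by rewrite ltxx subrr mul0r mul0e.
apply/seteqP; split => [p /= pab|p [/= p1 p2] i].
  split; first by rewrite /= -[p.1]consE; exact: pab.
  by move=> i; rewrite -consS /a' /b' !shift; exact: pab.
case: (unliftP ord0 i) => [j|] ->; last by rewrite consE.
by rewrite consS -!shift; exact: p2.
Qed.

End lebesgue_rV.

Section domains.
Variables (R : realType) (d : nat).
Implicit Types (x : 'rV[R]_d) (Omega : set 'rV[R]_d).

Definition enorm x : R := Num.sqrt (\sum_(i < d) x ord0 i ^+ 2).

(* Near each boundary point, Omega is the strict epigraph of a Lipschitz
   function in the orthonormal coordinates y = x *m Q: the vertical coordinate is
   the i-th one and [col' i y] collects the d - 1 others. The library's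
   [lipschitz] is for the sup norm, equivalent to the Euclidean one. *)
Definition lipschitz_boundary Omega :=
  forall x0, (closure Omega `\` Omega°) x0 ->
  exists (r : R) (Q : 'M[R]_d) (i : 'I_d) (gamma : 'rV[R]_d.-1 -> R^o),
    [/\ 0 < r, Q *m Q^T = 1%:M, lipschitz gamma &
        forall x, enorm (x - x0) < r ->
          (Omega x <-> gamma (col' i (x *m Q)) < (x *m Q) ord0 i)].

Section lebesgue_on.
Variables (Omega : set 'rV[R]_d) (oOmega : open Omega).

Definition lebesgue_on : set 'rV[R]_d -> \bar R :=
  mrestr (lebesgue_rV R d) (open_measurable_rV oOmega).

HB.instance Definition _ := Measure.on lebesgue_on.

End lebesgue_on.
End domains.

(* An element of L^2(mu) is given by a square-integrable function, and equality
   in L^2(mu) is mu-a.e. equality; [L2norm] is the norm of L^2(mu), hence only a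
   seminorm on the type [L2 mu]. *)
Notation L2 mu := (LfunType mu (lee1n 2)).

Section L2_valued.
Context {disp : measure_display} {X : measurableType disp} {R : realType}.
Variable mu : {measure set X -> \bar R}.

Definition L2norm (f : X -> R) : R := fine ('N[mu]_2%:E[EFin \o f])%E.

Record simple_fun := SimpleFun {
  sf_size : nat ;
  sf_set : 'I_sf_size -> set R ;
  sf_val : 'I_sf_size -> L2 mu ;
  sf_measurable : forall i, measurable (sf_set i) }.

Definition sf_eval (s : simple_fun) (t : R) : L2 mu :=
  \sum_(i < sf_size s) \1_(sf_set i) t *: sf_val i.

Definition sf_integral (D : set R) (s : simple_fun) : L2 mu :=
  \sum_(i < sf_size s)
    fine (@lebesgue_measure R (D `&` sf_set i)) *: sf_val i.

Definition strongly_measurable (D : set R) (f : R -> L2 mu) :=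
  exists s : nat -> simple_fun,
    {ae @lebesgue_measure R, forall t, D t ->
      L2norm (f t - sf_eval (s k) t) @[k --> \oo] --> (0 : R)}.

(* D is meant to have finite measure; I is determined up to mu-a.e. equality. *)
Definition is_bochner_integral (D : set R) (f : R -> L2 mu) (I : L2 mu) :=
  strongly_measurable D f /\
  exists s : nat -> simple_fun,
    (\int[@lebesgue_measure R]_(t in D)
        (L2norm (f t - sf_eval (s k) t))%:E)%E @[k --> \oo] --> (0%E : \bar R) /\
    L2norm (sf_integral D (s k) - I) @[k --> \oo] --> (0 : R).

Definition bochner_L2 (D : set R) (f : R -> L2 mu) :=
  strongly_measurable D f /\
  (\int[@lebesgue_measure R]_(t in D) (L2norm (f t) ^+ 2)%:E < +oo)%E.

(* Test functions of class C^1 with compact support in the open interval ]0, T[,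
   as in Brezis' definition of Sobolev spaces on an interval. *)
Definition test_function (T : R) (phi : R -> R) :=
  [/\ forall t, derivable phi t 1, continuous (phi^`())%classic &
      exists a b, [/\ 0 < a, b < T & forall t, t \notin `[a, b] -> phi t = 0]].

Definition weak_derivative (T : R) (u g : R -> L2 mu) :=
  forall phi, test_function T phi -> exists I : L2 mu,
    is_bochner_integral `[0, T] (fun t => (phi^`())%classic t *: u t) I /\
    is_bochner_integral `[0, T] (fun t => phi t *: g t) (- I).

(* An element of H^1([0,T]; L^2(mu)) is given by its continuous representative,
   of which only the values on [0,T] matter, and (a version of) its weak
   derivative. *)
Record H1 (T : R) := MkH1 {
  H1_fun :> R -> L2 mu ;
  H1_deriv : R -> L2 mu ;
  H1_continuous : forall t, t \in `[0, T] ->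
    L2norm (H1_fun s - H1_fun t) @[s --> within [set` `[0, T]] (nbhs t)]
      --> (0 : R) ;
  H1_fun_L2 : bochner_L2 `[0, T] H1_fun ;
  H1_deriv_L2 : bochner_L2 `[0, T] H1_deriv ;
  H1_weak_derivative : weak_derivative T H1_fun H1_deriv }.

Definition H1_eq (T : R) (u v : H1 T) :=
  forall t, t \in `[0, T] -> u t = v t %[ae mu].

Definition H1_sqdist (T : R) (u v : H1 T) : \bar R :=
  (\int[@lebesgue_measure R]_(t in `[0%R, T])
    (L2norm (u t - v t) ^+ 2 + L2norm (H1_deriv u t - H1_deriv v t) ^+ 2)%:E)%E.

End L2_valued.

Section riesz.
Variables (R : realType) (d : nat).
Implicit Types (alpha sigma T : R) (Omega : set 'rV[R]_d) (u : 'rV[R]_d -> R).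

(* On the diagonal x = y, which is negligible, the quotient is _ / 0 = 0. *)
Definition riesz_energy alpha Omega u : R :=
  - \int[lebesgue_rV R d]_(x in Omega) \int[lebesgue_rV R d]_(y in Omega)
      (u x * u y / enorm (x - y) `^ (d%:R - alpha)).

Definition riesz_energy_limit Omega u : R :=
  - (\int[lebesgue_rV R d]_(x in Omega) u x) ^+ 2.

Definition riesz_potential alpha Omega u : 'rV[R]_d -> R := fun x =>
  2 * \int[lebesgue_rV R d]_(y in Omega) (u y / enorm (x - y) `^ (d%:R - alpha)).

Definition solves_riesz sigma alpha T Omega (oOmega : open Omega)
    (u0 : L2 (lebesgue_on oOmega)) (u : H1 (lebesgue_on oOmega) T) :=
  {ae @lebesgue_measure R, forall t, t \in `]0, T[ ->
    H1_deriv u t = (fun x => sigma * riesz_potential alpha Omega (u t) x)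
      %[ae lebesgue_on oOmega]} /\
  u 0 = u0 %[ae lebesgue_on oOmega].

Definition solves_limit sigma T Omega (oOmega : open Omega)
    (u0 : L2 (lebesgue_on oOmega)) (u : H1 (lebesgue_on oOmega) T) :=
  {ae @lebesgue_measure R, forall t, t \in `]0, T[ ->
    H1_deriv u t = (fun=> 2 * sigma * \int[lebesgue_rV R d]_(y in Omega) u t y)
      %[ae lebesgue_on oOmega]} /\
  u 0 = u0 %[ae lebesgue_on oOmega].

End riesz.

(* Main.v *)
Require Import Defs.
From HB Require Import structures.
From mathcomp Require Import all_boot all_order all_algebra.
From mathcomp Require Import all_classical all_reals all_analysis.
From mathcomp Require Import measurable_realfun.
From mathcomp Require Import ring lra.

(** Both evolution equations read u' = 2 sigma K u, where K is the integral
    operator on L2(Omega) with a symmetric kernel: the Riesz kernel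
    |x - y|^(-s), with s = d - alpha_n, or the constant kernel 1. Schur's test
    bounds an integral operator by the supremum over x of the integral over y of
    its kernel ([kernel_sqr_bound]). As Omega is bounded and s < d, both
    operators are bounded, and the difference of the two has norm at most
      sup_x int_Omega | |x - y|^(-s) - 1 | dy = O(s),
    by convexity of s |-> |x - y|^(-s) ([riesz_kernel_cvg]). The theorem is thus
    about linear differential equations in a Hilbert space whose bounded
    operators converge in norm.

    Existence ([linear_evolution_exists]): the exponential series of the operator
    converges by completeness of L2 ([L2_complete]). That its sum has the expected
    weak derivative is checked after pairing with a fixed vector w: the pairing
    commutes with Bochner integrals ([bochner_dot]), and the paired solution is a
    power series in t, which can be differentiated termwise and integrated by
    parts.

    Stability ([evolves_stability]): the difference of two evolutions, paired with
    a fixed vector, satisfies a scalar differential inequality in the weak sense,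
    which C1 cut-off functions turn into a pointwise one ([weak_comparison]). A
    Gronwall argument then bounds the difference by the distance of the initial
    data plus the distance of the operators. Equal operators give uniqueness; the
    operators above give uniform convergence in time, first of the solutions, then
    of their derivatives through the equations, hence convergence in H1
    ([evolves_cvg]). The energies converge because they are the quadratic forms
    - <u, K u> ([riesz_energyE], [riesz_energy_limitE]). *)

Set Implicit Arguments.
Unset Strict Implicit.
Unset Printing Implicit Defensive.
Import Order.TTheory GRing.Theory Num.Theory.
Import numFieldNormedType.Exports.
Local Open Scope classical_set_scope.
Local Open Scope ring_scope.

(** * The inner product and seminorm of L2 *)

Section L2_dot.
Context {disp} {X : measurableType disp} {R : realType}.
Variable mu : {measure set X -> \bar R}.
Implicit Types (f g h : L2 mu) (c : R).
Local Notation N := (L2norm mu).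

Definition dot f g : R := \int[mu]_x (f x * g x).

Lemma integrable_L2_mul f g : mu.-integrable setT (fun x => (f x * g x)%:E).
Proof.
have := Lfun2_mul_Lfun1 (LfunP f) (LfunP g).
by move/Lfun1_integrable.
Qed.

Lemma L2norm_ge0 f : 0 <= N f.
Proof. by rewrite fine_ge0// Lnorm_ge0. Qed.

Lemma EFin_L2norm f : (N f)%:E = 'N[mu]_2%:E[EFin \o f]%E.
Proof. exact: finite_norm_fine. Qed.

Lemma L2norm_sqr_int f : ((N f) ^+ 2)%:E = (\int[mu]_x (f x ^+ 2)%:E)%E.
Proof.
rewrite -powR_mulrn ?L2norm_ge0// -poweR_EFin EFin_L2norm poweR_Lnorm//.
apply: eq_integral => x _; rewrite -[(EFin \o f) x]/((f x)%:E) abse_EFin poweR_EFin.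
by rewrite powR_mulrn// real_normK// num_real.
Qed.

Lemma L2norm_sqr f : N f ^+ 2 = dot f f.
Proof.
rewrite /dot /Rintegral.
rewrite (_ : (\int[mu]_x (f x * f x)%:E)%E = (N f ^+ 2)%:E)// L2norm_sqr_int.
by apply: eq_integral => x _; rewrite expr2.
Qed.

Lemma dotC f g : dot f g = dot g f.
Proof. by apply: eq_Rintegral => x _; rewrite mulrC. Qed.

Lemma dotDl f g h : dot (f + g) h = dot f h + dot g h.
Proof.
rewrite /dot -RintegralD//; try exact: integrable_L2_mul.
by apply: eq_Rintegral => x _; rewrite -mulrDl.
Qed.

Lemma dotZl c f h : dot (c *: f) h = c * dot f h.
Proof.
rewrite /dot -RintegralZl//; try exact: integrable_L2_mul.
by apply: eq_Rintegral => x _; rewrite mulrA.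
Qed.

Lemma dotNl f h : dot (- f) h = - dot f h.
Proof. by rewrite -scaleN1r dotZl mulN1r. Qed.

Lemma dotBl f g h : dot (f - g) h = dot f h - dot g h.
Proof. by rewrite dotDl dotNl. Qed.

Lemma dot0l h : dot 0 h = 0.
Proof. by rewrite -[0](subrr 0) dotBl subrr. Qed.

Lemma dotBr f g h : dot f (g - h) = dot f g - dot f h.
Proof. by rewrite dotC dotBl !(dotC _ f). Qed.

Lemma dot_suml I (r : seq I) (F : I -> L2 mu) h :
  dot (\sum_(i <- r) F i) h = \sum_(i <- r) dot (F i) h.
Proof.
elim: r => [|i r IH]; first by rewrite !big_nil dot0l.
by rewrite !big_cons dotDl IH.
Qed.

Lemma L2normD f g : N (f + g) <= N f + N g.
Proof. exact: ler_LnormD. Qed.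

Lemma L2normZ c f : N (c *: f) = `|c| * N f.
Proof.
have : (N (c *: f)) ^+ 2 = (`|c| * N f) ^+ 2.
  rewrite L2norm_sqr dotZl dotC dotZl mulrA -expr2 exprMn L2norm_sqr.
  by rewrite real_normK ?num_real.
move/eqP; rewrite eqrXn2 ?L2norm_ge0 ?mulr_ge0 ?L2norm_ge0//; exact: eqP.
Qed.

Lemma L2norm0 : N 0 = 0.
Proof. by have := L2normZ 0 0; rewrite scaler0 normr0 mul0r. Qed.

Lemma L2normN f : N (- f) = N f.
Proof. by rewrite -scaleN1r L2normZ normrN1 mul1r. Qed.

Lemma L2normBC f g : N (f - g) = N (g - f).
Proof. by rewrite -L2normN opprB. Qed.

Lemma L2normB f g : N (f - g) <= N f + N g.
Proof. by rewrite (le_trans (L2normD _ _))// L2normN. Qed.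

Lemma L2dist_triangle f g h : N (f - h) <= N (f - g) + N (g - h).
Proof. by rewrite (le_trans _ (L2normD _ _))// addrA subrK. Qed.

Lemma L2norm_dist f g : `|N f - N g| <= N (f - g).
Proof.
rewrite ler_norml; apply/andP; split.
  by have := L2normD (g - f) f; rewrite subrK L2normBC; lra.
by have := L2normD (f - g) g; rewrite subrK; lra.
Qed.

Lemma L2norm_sum I (r : seq I) (F : I -> L2 mu) :
  N (\sum_(i <- r) F i) <= \sum_(i <- r) N (F i).
Proof.
elim: r => [|i r IH]; first by rewrite !big_nil L2norm0.
by rewrite !big_cons (le_trans (L2normD _ _))// lerD2l.
Qed.

Lemma cauchy_schwarz f g : `|dot f g| <= N f * N g.
Proof.
rewrite (le_trans (le_normr_Rintegral _ (integrable_L2_mul f g)))//.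
rewrite -lee_fin EFinM !EFin_L2norm.
have := @hoelder _ _ _ mu f g 2 2.
rewrite Lnorm1 => /(_ _ _ _ _ _) h.
apply: le_trans (h _ _ _ _ _) => //; last by rewrite [RHS]splitr !div1r.
rewrite /Rintegral fineK//.
have := integrable_abse (integrable_L2_mul f g).
by move/integrable_fin_num; apply.
Qed.

(** Taking w = f shows that the norm is detected by pairings; this is how
    vector-valued estimates are reduced to scalar ones below. *)
Lemma L2norm_le_dot f c : 0 <= c -> (forall w, dot f w <= c * N w) -> N f <= c.
Proof.
move=> c0 /(_ f); rewrite -L2norm_sqr expr2.
have [->//|f0] := eqVneq (N f) 0.
by rewrite ler_pM2r// lt_neqAle eq_sym f0 L2norm_ge0.
Qed.

Lemma L2norm_eq0_ae f : N f = 0 <-> f = 0 %[ae mu].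
Proof.
split; first exact: fine_Lnormr_eq0.
move=> f0.
suff : N f ^+ 2 = 0 by move/eqP; rewrite expf_eq0/= => /eqP.
apply: EFin_inj; rewrite L2norm_sqr_int.
rewrite (@ae_eq_integral _ _ _ mu setT (cst 0%E) (fun x => (f x ^+ 2)%:E))//.
- by rewrite integral0.
- by apply/measurable_EFinP; apply: measurable_funX.
- by apply: filterS f0 => x /(_ I) /= ->; rewrite expr0n.
Qed.

Lemma L2dist_eq0_ae f g : N (f - g) = 0 <-> f = g %[ae mu].
Proof.
rewrite L2norm_eq0_ae; split; apply: filterS => x /(_ I) /=.
  by move/eqP; rewrite subr_eq0 => /eqP.
by move=> fg _; rewrite /= -/(f x) -/(g x); apply/eqP; rewrite subr_eq0; apply/eqP.
Qed.

Lemma dot_cvg (f_ g_ : nat -> L2 mu) f g :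
  N (f_ n - f) @[n --> \oo] --> (0 : R) -> N (g_ n - g) @[n --> \oo] --> (0 : R) ->
  dot (f_ n) (g_ n) @[n --> \oo] --> dot f g.
Proof.
move=> cf cg.
have -> : (fun n => dot (f_ n) (g_ n)) = 
  (fun n => dot f g + (dot (f_ n - f) (g_ n - g) + dot (f_ n - f) g + dot f (g_ n - g))).
  by apply/funext => n; rewrite !dotBl !dotBr; ring.
rewrite -[X in _ --> X]addr0; apply: cvgD; first exact: cvg_cst.
apply/norm_cvg0P.
apply: (@squeeze_cvgr _ _ _ _ (cst 0) (fun n =>
  N (f_ n - f) * N (g_ n - g) + N (f_ n - f) * N g + N f * N (g_ n - g))).
- apply: nearW => n; rewrite normr_ge0/= (le_trans (ler_normD _ _))// lerD ?cauchy_schwarz//.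
  by rewrite (le_trans (ler_normD _ _))// lerD ?cauchy_schwarz.
- exact: cvg_cst.
- rewrite [X in _ --> X](_ : _ = 0 * 0 + 0 * N g + N f * 0); last by ring.
  apply: cvgD; first apply: cvgD.
  + exact: cvgM.
  + by apply: cvgM => //; exact: cvg_cst.
  + by apply: cvgM => //; exact: cvg_cst.
Qed.

End L2_dot.

(** * Completeness of L2 *)

Section L2_complete.
Context {disp} {X : measurableType disp} {R : realType}.
Variable mu : {measure set X -> \bar R}.
Local Notation N := (L2norm mu).

Lemma L2subE (f g : L2 mu) x : (f - g) x = f x - g x.
Proof. by []. Qed.

Lemma measurable_L2 (f : L2 mu) : measurable_fun setT f.
Proof. by []. Qed.

Lemma L2_of_sqr_int (f : X -> R) : measurable_fun setT f ->
  (\int[mu]_x (f x ^+ 2)%:E < +oo)%E -> exists g : L2 mu, g = f :> (X -> R).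
Proof.
move=> mf fi.
have Pf : f \in Lfun mu 2%:E.
  rewrite inE; apply/andP; split; rewrite inE//=.
  rewrite /finite_norm unlock /Lnorm poweR_lty//.
  rewrite (eq_integral (fun x => (f x ^+ 2)%:E))// => x _.
  by rewrite -[(EFin \o f) x]/((f x)%:E) abse_EFin poweR_EFin powR_mulrn// real_normK//
    num_real.
by exists (Lfun_Sub (lee1n 2) Pf).
Qed.

(** The series of 4^k |s_(k+1) - s_k|^2 has a finite integral, so it is finite
    almost everywhere, and there the increments are O(2^-k). *)
Lemma fast_cauchy_ae_cvg (s : nat -> L2 mu) :
  (forall k, N (s k.+1 - s k) <= 4^-1 ^+ k) -> {ae mu, forall x, cvgn (s ^~ x)}.
Proof.
move=> sN.
pose a k x : \bar R := (4 ^+ k * (s k.+1 x - s k x) ^+ 2)%:E.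
have a0 k x : (0 <= a k x)%E by rewrite lee_fin; apply: mulr_ge0;
  [exact: exprn_ge0|exact: sqr_ge0].
have ma k : measurable_fun setT (a k).
  apply/measurable_EFinP; apply: measurable_funM => //.
  by apply: measurable_funX; apply: measurable_funB.
have ia k : (\int[mu]_x a k x <= (4^-1 ^+ k)%:E)%E.
  under eq_integral do rewrite /a EFinM.
  rewrite ge0_integralZl_EFin ?exprn_ge0//; last 2 first.
  - by move=> x _; rewrite lee_fin sqr_ge0.
  - by apply/measurable_EFinP; apply: measurable_funX; apply: measurable_funB.
  rewrite -(L2norm_sqr_int (s k.+1 - s k)) -EFinM lee_fin.
  rewrite (@le_trans _ _ (4 ^+ k * (4^-1 ^+ k) ^+ 2))//.
    by rewrite ler_pM2l ?exprn_gt0// lerXn2r ?nnegrE ?L2norm_ge0 ?exprn_ge0 ?invr_ge0.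
  by rewrite expr2 mulrA -exprMn mulfV ?expr1n ?mul1r.
have mA : measurable_fun setT (fun x => \sum_(0 <= k <oo) a k x)%E.
  by apply: ge0_emeasurable_sum => // k x _ _.
have iA : mu.-integrable setT (fun x => \sum_(0 <= k <oo) a k x)%E.
  apply/integrableP; split => //.
  under eq_integral do rewrite gee0_abs ?nneseries_ge0//.
  rewrite integral_nneseries//.
  apply: (@le_lt_trans _ _ (\sum_(0 <= k <oo) (4^-1 ^+ k)%:E)%E).
    by apply: lee_nneseries => // k _; rewrite integral_ge0.
  have cg : cvgn (series (geometric 1 (4^-1 : R))).
    by apply: is_cvg_geometric_series; rewrite ger0_norm ?invr_ge0// invf_lt1// ltr1n.
  rewrite (_ : (fun n : nat => _) = EFin \o series (geometric 1 (4^-1 : R))).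
    by rewrite EFin_lim// ltry.
  apply/funext => n; rewrite /series/= sumEFin; congr EFin.
  by apply: eq_bigr => k _; rewrite mul1r.
have := integrable_ae measurableT iA.
apply: filterS => x /(_ I) Afin.
set M := fine (\sum_(0 <= k <oo) a k x)%E in Afin *.
have aM k : 4 ^+ k * (s k.+1 x - s k x) ^+ 2 <= M.
  rewrite -lee_fin fineK//.
  rewrite (le_trans _ (nneseries_lim_ge k.+1 _))//.
  by rewrite big_nat_recr//= leeDr// sume_ge0.
have M0 : 0 <= M by rewrite (le_trans _ (aM 0%N))// mulr_ge0 ?sqr_ge0.
have dk k : `|s k.+1 x - s k x| <= geometric (Num.sqrt M) (2^-1) k.
  rewrite /= -(@ler_pXn2r _ 2)// ?nnegrE ?mulr_ge0 ?sqrtr_ge0 ?exprn_ge0 ?invr_ge0//.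
  rewrite real_normK ?num_real// exprMn sqr_sqrtr// -exprM mulnC exprM.
  rewrite -(@ler_pM2l _ (4 ^+ k)) ?exprn_gt0// [leRHS]mulrCA -exprMn.
  by rewrite (_ : 4 * 2^-1 ^+ 2 = 1 :> R) ?expr1n ?mulr1//; field.
have -> : s ^~ x = (fun n => s 0%N x + series (fun k => s k.+1 x - s k x) n).
  by apply/funext => n; rewrite /series/= telescope_sumr// addrC subrK.
apply: is_cvgD; first exact: is_cvg_cst.
apply: normed_cvg.
apply: (series_le_cvg _ _ dk) => //.
- by move=> n /=; rewrite mulr_ge0 ?sqrtr_ge0 ?exprn_ge0 ?invr_ge0.
- by apply: is_cvg_geometric_series; rewrite ger0_norm ?invr_ge0// invf_lt1// ltr1n.
Qed.

(** A fast subsequence converges almost everywhere, and Fatou's lemma bounds the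
    distance of the sequence to the pointwise limit. *)
Lemma L2_complete (s : nat -> L2 mu) :
  (forall e, 0 < e -> exists n0, forall m n, (n0 <= m)%N -> (n0 <= n)%N ->
     N (s m - s n) <= e) ->
  exists f : L2 mu, N (s n - f) @[n --> \oo] --> (0 : R).
Proof.
move=> cs.
have q0 k : 0 < 4^-1 ^+ k :> R by rewrite exprn_gt0 ?invr_gt0.
have /choice[n0 n0P] k := cs _ (q0 k).
(* p k >= n0 k makes the subsequence fast, and the successor makes it cofinal *)
pose p := fix p k := if k is k'.+1 then maxn (n0 k) (p k').+1 else n0 0%N.
have pn0 k : (n0 k <= p k)%N by case: k => //= k; rewrite leq_maxl.
have pS k : (p k <= p k.+1)%N by rewrite /= leq_max leqnSn orbT.
have /fast_cauchy_ae_cvg cvgp : forall k, N (s (p k.+1) - s (p k)) <= 4^-1 ^+ k.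
  by move=> k; apply: n0P => //; rewrite (leq_trans (pn0 k)).
have pk k : (k <= p k)%N by elim: k => // k IH; rewrite /= leq_max ltnS IH orbT.
pose f x := fine (limn_esup (fun k => (s (p k) x)%:E)).
have mf : measurable_fun setT f.
  apply: measurableT_comp => //.
  apply: (measurable_fun_limn_esup (f := fun k x => (s (p k) x)%:E)) => k.
  exact/measurable_EFinP.
have cf : {ae mu, forall x, s (p k) x @[k --> \oo] --> f x}.
  apply: filterS cvgp => x cx.
  have c1 : (s (p k) x)%:E @[k --> \oo] --> (limn (fun k => s (p k) x))%:E.
    by apply: cvg_EFin; [exact: nearW|exact: cx].
  by rewrite /f (cvg_limn_einf_sup c1).2; exact: cx.
have key e n1 n : (n1 <= n)%N -> (forall m, (n1 <= m)%N -> N (s n - s m) <= e) ->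
    (\int[mu]_x ((s n x - f x) ^+ 2)%:E <= (e ^+ 2)%:E)%E.
  move=> n1n ne.
  pose g k x : \bar R := ((s n x - s (p k) x) ^+ 2)%:E.
  have mg k : measurable_fun setT (g k).
    by apply/measurable_EFinP; apply: measurable_funX; apply: measurable_funB.
  have g0 k x : setT x -> (0 <= g k x)%E by rewrite lee_fin sqr_ge0.
  have e0 : 0 <= e by rewrite (le_trans _ (ne _ n1n))// L2norm_ge0.
  rewrite (@ae_eq_integral _ _ _ mu setT (fun x => limn_einf (g ^~ x)))//; last 3 first.
  - apply/measurable_EFinP; apply: measurable_funX; exact: measurable_funB.
  - rewrite (_ : (fun x => _) = \- (fun x => limn_esup (fun k => - g k x)))%E.
      apply: measurableT_comp => //.
      apply: (measurable_fun_limn_esup (f := fun k x => - g k x)%E) => k.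
      exact: measurableT_comp.
    apply/funext => x; rewrite -limn_einfN; congr limn_einf.
    by apply/funext => k; rewrite /comp oppeK.
  - apply: filterS cf => x cx _; apply/esym.
    suff /cvg_limn_einf_sup[//] : g k x @[k --> \oo] --> ((s n x - f x) ^+ 2)%:E.
    apply: cvg_EFin; first exact: nearW.
    by apply: cvgM; (apply: cvgB; [exact: cvg_cst|exact: cx]).
  rewrite (le_trans (fatou _ _ mg g0))//.
  rewrite limn_einf_lim; apply: lime_le; first exact: is_cvg_einfs.
  near=> k; apply: ereal_inf_le.
  exists (\int[mu]_x g (maxn k n1) x)%E.
    by exists (maxn k n1) => //=; rewrite leq_maxl.
  rewrite -(L2norm_sqr_int (s n - s (p (maxn k n1)))) lee_fin.
  rewrite lerXn2r ?nnegrE ?L2norm_ge0// ne//.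
  by rewrite (leq_trans _ (pk _))// leq_maxr.
have [n1 n1P] := cs 1 ltr01.
have [h hE] : exists h : L2 mu, h = (fun x => s n1 x - f x) :> (X -> R).
  apply: L2_of_sqr_int; first exact: measurable_funB.
  rewrite (le_lt_trans (key 1 n1 n1 _ _)) ?ltry// => m m1; exact: n1P.
have nf n x : (s n - (s n1 - h)) x = s n x - f x.
  by rewrite !L2subE hE; ring.
exists (s n1 - h); apply/cvgrPdist_le => e e0.
have [n2 n2P] := cs e e0.
near=> n; rewrite sub0r normrN ger0_norm ?L2norm_ge0//.
rewrite -(@ler_pXn2r _ 2)// ?nnegrE ?L2norm_ge0 ?(ltW e0)//.
rewrite -lee_fin L2norm_sqr_int; under eq_integral do rewrite nf.
have nn2 : (n2 <= n)%N by near: n; exact: nbhs_infty_ge.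
by apply: (key _ n2) => // m mn; exact: n2P.
Unshelve. all: end_near. Qed.

End L2_complete.

(** * Bochner integrals *)

Section lower_integral.
Context {disp} {X : measurableType disp} {R : realType}.
Variable mu : {measure set X -> \bar R}.
Import HBNNSimple.

(** The integral of a nonnegative function is the supremum of the integrals of
    the simple functions below it, hence it is monotone without any measurability
    assumption. This matters for integrands such as t |-> L2norm (f t - s t) where
    f is specified only for almost every t: they need not be Borel measurable. *)
Lemma ae_ge0_le_lower_integral (D : set X) (f g : X -> \bar R) :
  (forall x, D x -> 0 <= f x)%E -> (forall x, D x -> 0 <= g x)%E ->
  {ae mu, forall x, D x -> (f x <= g x)%E} ->
  (\int[mu]_(x in D) f x <= \int[mu]_(x in D) g x)%E.
Proof.
move=> f0 g0 [M [mM M0 fgM]].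
rewrite ge0_integralE// [leRHS]ge0_integralE//.
apply: ge_ereal_sup => _ [h hf <-].
(* truncate h to 0 on the exceptional set; its integral does not change *)
pose h' := proj_nnsfun h (measurableC mM).
have -> : sintegral mu h = sintegral mu h'.
  rewrite -!integralT_nnsfun; apply: ae_eq_integral => //.
  - exact/measurable_EFinP.
  - exact/measurable_EFinP.
  - exists M; split => // x /= /not_implyP[_ hx]; apply: contrapT => nMx; apply: hx.
    by rewrite mindicE mem_set ?mulr1.
apply: ereal_sup_ubound; exists h' => // x.
rewrite /= mindicE; have [Mx|Mx] := boolP (x \in ~` M); rewrite ?mulr0 ?mulr1.
  apply: le_trans (hf x) _; rewrite /patch; case: ifPn => // Dx.
  apply: contrapT => nfg; rewrite inE /= in Mx; apply/Mx/fgM => /= /(_ (set_mem Dx)).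
  exact/nfg.
by rewrite /patch; case: ifPn => // /set_mem /g0.
Qed.
End lower_integral.

Lemma ae_lebesgueS (R : realType) (P Q : R -> Prop) : (forall t, P t -> Q t) ->
  {ae @lebesgue_measure R, forall t, P t} -> {ae @lebesgue_measure R, forall t, Q t}.
Proof.
move=> PQ [M [mM M0 sub]]; exists M; split => // t /= nQ; apply: sub => /= Pt.
exact/nQ/PQ.
Qed.

Lemma ae_lebesgueI (R : realType) (P Q : R -> Prop) :
  {ae @lebesgue_measure R, forall t, P t} -> {ae @lebesgue_measure R, forall t, Q t} ->
  {ae @lebesgue_measure R, forall t, P t /\ Q t}.
Proof.
move=> [M [mM M0 subM]] [M' [mM' M0' subM']]; exists (M `|` M'); split => //.
- exact: measurableU.
- exact: null_set_setU.
- move=> t /= /not_andP[nP|nQ]; [left; exact: subM|right; exact: subM'].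
Qed.

Section bochner.
Context {disp} {X : measurableType disp} {R : realType}.
Variable mu : {measure set X -> \bar R}.
Local Notation N := (L2norm mu).
Local Notation leb := (@lebesgue_measure R).
Implicit Types (D : set R) (s : simple_fun mu).

Lemma dot_sf_eval s t w :
  dot (sf_eval s t) w = \sum_(i < sf_size s) \1_(sf_set i) t * dot (sf_val i) w.
Proof. by rewrite dot_suml; apply: eq_bigr => i _; rewrite dotZl. Qed.

Lemma integrable_indic_scale D (A : set R) (c : R) :
  measurable D -> (leb D < +oo)%E -> measurable A ->
  leb.-integrable D (fun t => (c%:E * (\1_A t)%:E)%E).
Proof.
move=> mD Doo mA; apply: integrableZl => //; apply/integrableP; split.
  exact/measurable_EFinP.
under eq_integral do rewrite gee0_abs ?lee_fin//.
rewrite integral_indic//; apply: le_lt_trans Doo.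
apply: le_measure; rewrite ?inE//; exact: measurableI.
Qed.

Lemma integrable_sf_dot D s w : measurable D -> (leb D < +oo)%E ->
  leb.-integrable D (fun t => (dot (sf_eval s t) w)%:E).
Proof.
move=> mD Doo; under eq_fun do rewrite dot_sf_eval -sumEFin.
apply: integrable_sum => // i _.
under eq_fun do rewrite mulrC EFinM.
by apply: integrable_indic_scale => //; exact: sf_measurable.
Qed.

Lemma dot_sf_integral D s w : measurable D -> (leb D < +oo)%E ->
  dot (sf_integral D s) w = \int[leb]_(t in D) dot (sf_eval s t) w.
Proof.
move=> mD Doo; rewrite dot_suml; apply: EFin_inj.
rewrite /Rintegral fineK; last first.
  exact/integrable_fin_num/integrable_sf_dot.
have -> : (fun t => (dot (sf_eval s t) w)%:E) =
    (fun t => \sum_(i < sf_size s) ((dot (sf_val i) w)%:E * (\1_(sf_set i) t)%:E))%E.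
  by apply/funext => t; rewrite dot_sf_eval -sumEFin; apply: eq_bigr => i _;
    rewrite mulrC EFinM.
rewrite integral_sum//; last first.
  by move=> i; apply: integrable_indic_scale => //; exact: sf_measurable.
rewrite -sumEFin; apply: eq_bigr => i _.
have mI := sf_measurable i.
rewrite integralZl//; last first.
  have := integrable_indic_scale 1 mD Doo mI.
  by under eq_fun do rewrite mul1e.
have fin : leb (D `&` sf_set i) \is a fin_num.
  rewrite ge0_fin_numE//; apply: le_lt_trans Doo.
  apply: le_measure; rewrite ?inE//; exact: measurableI.
rewrite dotZl mulrC EFinM (fineK fin); congr (_ * _)%E.
by rewrite integral_indic// setIC.
Qed.

(** The pairing with w commutes with the Bochner integral, because
    |<s_k t, w> - h t| is at most (N w) * N (f t - s_k t). Prescribing h only almost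
    everywhere lets h be a continuous function while f is an arbitrary version. *)
Lemma bochner_dot D (f : R -> L2 mu) J w (h : R -> R) :
  measurable D -> (leb D < +oo)%E ->
  is_bochner_integral D f J -> leb.-integrable D (EFin \o h) ->
  {ae leb, forall t, D t -> dot (f t) w = h t} ->
  dot J w = \int[leb]_(t in D) h t.
Proof.
move=> mD Doo [_ [s [s0 sJ]]] ih fh.
(* N w + 1 instead of N w, to be able to divide by it *)
set c := N w + 1.
have c0 : 0 < c by rewrite ltr_wpDl ?L2norm_ge0.
have iS k := integrable_sf_dot (s k) w mD Doo.
pose b k t := dot (sf_eval (s k) t) w - h t.
have ib k : leb.-integrable D (EFin \o b k).
  by rewrite (_ : EFin \o b k = (fun t => (dot (sf_eval (s k) t) w)%:E) \-
    (EFin \o h))%E//; exact: integrableB.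
have bound k : (`|dot (sf_integral D (s k)) w - \int[leb]_(t in D) h t|%:E <=
   c%:E * \int[leb]_(t in D) (N (f t - sf_eval (s k) t))%:E)%E.
  rewrite dot_sf_integral// -RintegralB//; last exact: iS.
  rewrite EFin_normr_Rintegral//; last exact: ib.
  have /le_trans := le_abse_integral leb mD (measurable_int leb (ib k)); apply.
  rewrite -lee_pdivrMl// -ge0_integralZl_EFin//; last 2 first.
  - by apply: measurableT_comp => //; exact: measurable_int (ib k).
  - by rewrite invr_ge0 ltW.
  apply: ae_ge0_le_lower_integral.
  - by move=> t _; rewrite mule_ge0// lee_fin invr_ge0 ltW.
  - by move=> t _; rewrite lee_fin L2norm_ge0.
  - apply: ae_lebesgueS fh => t /[apply] ft.
    rewrite lee_pdivrMl// -EFinM lee_fin /b -ft -dotBl.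
    rewrite (le_trans (cauchy_schwarz _ _))// L2normBC mulrC.
    by rewrite ler_wpM2r ?L2norm_ge0// lerDl.
have lim1 : dot (sf_integral D (s k)) w @[k --> \oo] --> dot J w.
  by apply: dot_cvg => //; rewrite subrr L2norm0; exact: cvg_cst.
have lim2 : `|dot (sf_integral D (s k)) w - \int[leb]_(t in D) h t| @[k --> \oo] --> (0 : R).
  apply: (@fine_cvg _ _ _ _ (fun k =>
    `|dot (sf_integral D (s k)) w - \int[leb]_(t in D) h t|%:E)).
  apply: (@squeeze_cvge _ _ _ _ (cst 0%E) _
    (fun k => c%:E * \int[leb]_(t in D) (N (f t - sf_eval (s k) t))%:E)%E).
  - by apply: nearW => k; rewrite lee_fin normr_ge0/=; exact: bound.
  - exact: cvg_cst.
  - by rewrite -[X in _ --> X](mule0 c%:E); apply: cvgeZl.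
apply: cvg_unique lim1 _ => //.
by apply/subr_cvg0; apply/norm_cvg0P.
Qed.
End bochner.

Lemma cvge_nneg0 (R : realType) (u : nat -> \bar R) : (forall k, 0 <= u k)%E ->
  (forall e : R, 0 < e -> \forall k \near \oo, (u k <= e%:E)%E) ->
  u k @[k --> \oo] --> 0%:E.
Proof.
move=> u0 ue; apply/fine_cvgP; split.
  have := ue 1 ltr01; apply: filterS => k uk.
  by rewrite ge0_fin_numE// (le_lt_trans uk)// ltry.
apply/cvgrPdist_le => e e0; have := ue e e0; apply: filterS => k uk.
rewrite sub0r normrN ger0_norm ?fine_ge0//=.
by rewrite -lee_fin fineK// ge0_fin_numE// (le_lt_trans uk)// ltry.
Qed.

Section bochner_ucont.
Context {disp} {X : measurableType disp} {R : realType}.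
Variable mu : {measure set X -> \bar R}.
Local Notation N := (L2norm mu).
Local Notation leb := (@lebesgue_measure R).
Implicit Types (T s t e : R) (f : R -> L2 mu).

Definition ucont (T : R) (f : R -> L2 mu) := forall e : R, 0 < e ->
  exists2 r : R, 0 < r & forall s t, s \in `[0, T] -> t \in `[0, T] ->
    `|s - t| <= r -> N (f s - f t) <= e.

Definition node (T : R) (k i : nat) : R := T * i%:R / k.+1%:R.

Lemma measurable_step_set T k (i : 'I_k.+2) :
  measurable [set` `[node T k i, node T k i.+1[%R].
Proof. exact: measurable_itv. Qed.

(** There are k + 2 cells of width T / (k + 1), closed on the left, so that the
    right end T is covered too; the cells that meet [0, T] have their node in it. *)
Definition step_fun T (f : R -> L2 mu) k : simple_fun mu :=
  SimpleFun (fun i : 'I_k.+2 => f (node T k i)) (@measurable_step_set T k).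

Lemma node_itv T k i t : 0 < T -> (t \in `[node T k i, node T k i.+1[) =
  (i%:R <= t * k.+1%:R / T < i.+1%:R).
Proof.
move=> T0; rewrite in_itv/= /node ler_pdivrMr// ltr_pdivlMr//.
by rewrite ler_pdivlMr// ltr_pdivrMr// ![_ * T]mulrC.
Qed.

Lemma step_fun_eval T f k t : 0 < T -> t \in `[0, T] ->
  exists s, [/\ s \in `[0, T], `|s - t| <= T / k.+1%:R &
    sf_eval (step_fun T f k) t = f s].
Proof.
move=> T0 /[dup] tT; rewrite in_itv/= => /andP[t0 t1].
set x := t * k.+1%:R / T.
have x0 : 0 <= x by rewrite divr_ge0 ?mulr_ge0// ltW.
have xk : x <= k.+1%:R by rewrite ler_pdivrMr// mulrC ler_wpM2l.
have /andP[ix xi] := truncn_itv x0.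
set i := Num.truncn x in ix xi.
have ik : (i < k.+2)%N by rewrite ltnS -(ler_nat R) (le_trans ix).
exists (node T k i).
have : t \in `[node T k i, node T k i.+1[ by rewrite node_itv// ix xi.
rewrite in_itv/= => /andP[it ti].
have nS : node T k i.+1 = node T k i + T / k.+1%:R.
  by rewrite /node -[X in T * X]natr1 mulrDr mulr1 mulrDl.
split.
- rewrite in_itv/= (le_trans it t1) andbT /node divr_ge0// mulr_ge0//.
  exact: ltW.
- by rewrite distrC ger0_norm ?subr_ge0//; rewrite lerBlDl -nS ltW.
- rewrite /sf_eval (bigD1 (Ordinal ik))//= big1 ?addr0.
    by rewrite indicE mem_set ?scale1r//= in_itv/= it ti.
  move=> j /eqP ji; rewrite indicE memNset ?scale0r//=.
  rewrite node_itv// -/x => /andP[jx xj]; apply: ji; apply/val_inj => /=.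
  apply/eqP; rewrite eqn_leq; apply/andP; split; rewrite -ltnS -(ltr_nat R).
    exact: le_lt_trans jx xi.
  exact: le_lt_trans ix xj.
Qed.

Lemma step_fun_near T f e : 0 < T -> ucont T f -> 0 < e -> \forall k \near \oo,
  forall t, t \in `[0, T] -> N (f t - sf_eval (step_fun T f k) t) <= e.
Proof.
move=> T0 uf e0; have [r r0 rP] := uf e e0.
near=> k => t tT; have [s [sT st ->]] := step_fun_eval f k T0 tT.
apply: rP => //; rewrite distrC (le_trans st)//.
rewrite ler_pdivrMr// mulrC -ler_pdivrMr// ltW//.
have : k.+1%:R^-1 < (T / r)^-1 :> R.
  near: k; apply: (near_infty_natSinv_lt (PosNum _)).
  by rewrite invr_gt0 divr_gt0.
by rewrite ltf_pV2// ?posrE ?divr_gt0.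
Unshelve. all: end_near. Qed.

Lemma ucont_strongly_measurable T f : 0 < T -> ucont T f ->
  strongly_measurable `[0, T] f.
Proof.
move=> T0 uf; exists (step_fun T f).
exists set0; split => // t /= /not_implyP[tT]; apply => {}.
apply/cvgrPdist_le => e e0.
have := step_fun_near T0 uf e0; apply: filterS => k /(_ t tT) h.
rewrite sub0r normrN ger0_norm; first exact: h.
have := L2norm_ge0 (f t - sf_eval (step_fun T f k) t). exact.
Qed.


Lemma lebesgue_itv0 T : 0 < T -> leb `[0, T]%classic = T%:E.
Proof.
by move=> T0; rewrite [LHS]lebesgue_measure_itv/= lte_fin T0 -EFinB subr0.
Qed.

(** By duality, as the pairing with w commutes with the integral. *)
Lemma sf_integral_dist T (s1 s2 : simple_fun mu) e : 0 < T -> 0 <= e ->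
  (forall t, t \in `[0, T] -> N (sf_eval s1 t - sf_eval s2 t) <= e) ->
  N (sf_integral `[0, T] s1 - sf_integral `[0, T] s2) <= e * T.
Proof.
move=> T0 e0 s12; apply: L2norm_le_dot => [|w]; first by rewrite mulr_ge0// ltW.
have mD : measurable (`[0, T]%classic : set R) by exact: measurable_itv.
have Doo : (leb `[0%R, T]%classic < +oo)%E by rewrite lebesgue_itv0// ltry.
rewrite dotBl !dot_sf_integral// -RintegralB//; try exact: integrable_sf_dot.
rewrite mulrAC.
have -> : e * N w * T = \int[leb]_(t in `[0, T]) (e * N w).
  rewrite Rintegral_cst// [X in fine X](_ : _ = T%:E)//; exact: lebesgue_itv0.
apply: le_Rintegral => //.
- exact: (@integrableB _ _ _ leb _ mD _ _ (integrable_sf_dot s1 w mD Doo)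
  (integrable_sf_dot s2 w mD Doo)).
- apply: measurable_bounded_integrable => //.
  exists `|e * N w|; split; first exact: num_real.
  by move=> M hM y _ /=; exact: ltW.
- move=> t tT; rewrite -dotBl (le_trans (ler_norm _))// (le_trans (cauchy_schwarz _ _))//.
  by rewrite ler_wpM2r ?L2norm_ge0// s12.
Qed.

(** The integrals of the step functions form a Cauchy sequence. *)
Lemma ucont_bochner T f : 0 < T -> ucont T f ->
  exists J, is_bochner_integral `[0, T] f J.
Proof.
move=> T0 uf.
have [J JP] : exists J : L2 mu,
    N (sf_integral `[0, T] (step_fun T f n) - J) @[n --> \oo] --> (0 : R).
  apply: L2_complete => e e0.
  have e20 : 0 < e / 2 / T by rewrite !divr_gt0.
  have [n0 _ n0P] := step_fun_near T0 uf e20.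
  exists n0 => m n mn0 nn0; rewrite (@le_trans _ _ (e / T * T))//.
    apply: sf_integral_dist => // [|t tT]; first by rewrite divr_ge0 ?ltW.
    rewrite (le_trans (L2dist_triangle _ (f t) _))// [X in X + _]L2normBC.
    rewrite (@le_trans _ _ (e / 2 / T + e / 2 / T))//.
      by apply: lerD; [exact: n0P mn0 _ tT|exact: n0P nn0 _ tT].
    by rewrite -mulrDl -splitr.
  by rewrite divfK ?gt_eqF.
exists J; split; first exact: ucont_strongly_measurable.
exists (step_fun T f); split => //; apply: cvge_nneg0.
  by move=> k; apply: integral_ge0 => t _; rewrite lee_fin L2norm_ge0.
move=> e e0; have eT : 0 < e / T by rewrite divr_gt0.
have := step_fun_near T0 uf eT; apply: filterS => k kP.
rewrite (@le_trans _ _ (\int[leb]_(t in `[0%R, T]) (e / T)%:E)%E)//.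
  apply: ae_ge0_le_lower_integral.
  - by move=> t _; rewrite lee_fin L2norm_ge0.
  - by move=> t _; rewrite lee_fin ltW.
  - exists set0; split => // t /= /not_implyP[tT]; apply => {}.
    by rewrite lee_fin kP.
by rewrite integral_cst//= lebesgue_itv0// -EFinM divfK// gt_eqF.
Qed.

End bochner_ucont.

(** * The exponential of a bounded operator *)

Section scalar_facts.
Context {R : realType}.
Local Notation leb := (@lebesgue_measure R).
Implicit Types (f g F G phi : R -> R).

Lemma heine_cantor f (T : R) : continuous f ->
  forall e : R, 0 < e -> exists2 r : R, 0 < r & forall s t, s \in `[0, T] ->
    `|s - t| <= r -> `|f s - f t| <= e.
Proof.
move=> cf e e0.
have := @segment_compact R 0 T; rewrite compact_near_coveringP.
move=> /(_ R (0^'+) (fun r x => forall t, `|x - t| <= r -> `|f x - f t| <= e)).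
case.
  move=> x _; have /cvgrPdist_le /(_ (e / 2)) := cf x.
  rewrite divr_gt0// => /(_ isT) [r /= r0 rP].
  exists (ball x (r / 2), [set s | s < r / 2]) => /=.
    split; first by apply: nbhsx_ballx; rewrite divr_gt0.
    by apply: nbhs_right_lt; rewrite divr_gt0.
  move=> [y s] /= [xy sr] t yt.
  rewrite (_ : f y - f t = (f x - f t) - (f x - f y)); last by ring.
  rewrite (le_trans (ler_normB _ _))// (splitr e); apply: lerD; apply: rP => /=.
    rewrite /ball/= in xy *.
    rewrite (_ : x - t = (x - y) + (y - t)); last by ring.
    rewrite (le_lt_trans (ler_normD _ _))// [ltRHS]splitr ltrD//.
    exact: le_lt_trans yt sr.
  by rewrite (lt_le_trans xy)// ler_pdivrMr// mulr_natr mulr2n lerDl ltW.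
move=> r /= r0 rP; exists (r / 2); first by rewrite divr_gt0.
move=> s t sT st; apply: (rP (r / 2)) => //=.
  rewrite sub0r normrN gtr0_norm ?divr_gt0// ltr_pdivrMr// mulr_natr mulr2n.
  by rewrite ltrDl.
by rewrite divr_gt0.
Qed.

Lemma continuous_integrable0 f (T : R) : continuous f ->
  leb.-integrable `[0, T] (EFin \o f).
Proof.
move=> cf; apply: continuous_compact_integrable; first exact: segment_compact.
exact: continuous_subspaceT.
Qed.

Lemma derivable_LRcontinuous f (a b : R) : (forall t, derivable f t 1) ->
  derivable_oo_LRcontinuous f a b.
Proof.
move=> df; have cf t : {for t, continuous f}.
  by apply: differentiable_continuous; apply/derivable1_diffP.
split=> [t _|//|]; first exact: df.
- by apply: cvg_at_right_filter; exact: cf.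
- by apply: cvg_at_left_filter; exact: cf.
Qed.

(** The boundary terms vanish as phi has compact support in ]0, T[. *)
Lemma parts_test T phi F G : 0 < T -> test_function T phi ->
  (forall t : R, is_derive t 1 F (G t)) -> continuous G ->
  \int[leb]_(t in `[0, T]) ((phi^`())%classic t * F t) =
  - \int[leb]_(t in `[0, T]) (phi t * G t).
Proof.
move=> T0 [dphi cphi [a [b [a0 bT phi0]]]] dF cG.
have dF' t : derivable F t 1 by have := dF t => -[].
have F'E t : (F^`())%classic t = G t by rewrite derive1E derive_val.
rewrite (_ : - _ = phi T * F T - phi 0 * F 0 - \int[leb]_(t in `[0, T]) (phi t * G t)).
  rewrite -[RHS](_ : \int[leb]_(t in `[0, T]) (F t * (phi^`())%classic t) = _).
    by apply: eq_Rintegral => t _; rewrite mulrC.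
  have h1 : {within `[0, T], continuous G} by exact: continuous_subspaceT.
  have h2 := derivable_LRcontinuous 0 T dF'.
  have h3 : {in `]0, T[, (F^`())%classic =1 G} by move=> t _; exact: F'E.
  have h4 : {within `[0, T], continuous (phi^`())%classic} by exact: continuous_subspaceT.
  have h5 := derivable_LRcontinuous 0 T dphi.
  have h6 : {in `]0, T[, (phi^`())%classic =1 (phi^`())%classic} by move=> t _.
  have -> := Rintegration_by_parts T0 h1 h2 h3 h4 h5 h6.
  rewrite mulrC [F 0 * _]mulrC; congr (_ - _).
  by apply: eq_Rintegral => t _; rewrite mulrC.
rewrite !phi0 ?mul0r ?subrr ?sub0r//; rewrite in_itv/= negb_and -!ltNge ?a0 ?bT ?orbT//.
Qed.

End scalar_facts.

Lemma itvccP (R : realType) (a b t : R) : t \in `[a, b] -> a <= t /\ t <= b.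
Proof. by rewrite in_itv/= => /andP[]. Qed.

Lemma le_cvg0 (R : realType) (x y : R) (u : nat -> R) :
  u n @[n --> \oo] --> (0 : R) -> (forall n, x <= u n + y) -> x <= y.
Proof.
move=> u0 xu; apply/ler_addgt0Pr => e e0.
have /cvgrPdist_le /(_ e e0) [n _ /(_ n (leqnn n))] := u0.
rewrite /= sub0r normrN => un.
by rewrite (le_trans (xu n))// addrC lerD2l (le_trans (ler_norm _)).
Qed.

Section exponential.
Context {disp} {X : measurableType disp} {R : realType}.
Variable mu : {measure set X -> \bar R}.
Local Notation N f := (L2norm mu (@Lfunction.sort _ _ _ mu _ (lee1n 2) f)).
Variables (A : L2 mu -> L2 mu) (C : R).
Hypothesis C0 : 0 <= C.
Hypothesis A_bounded : forall u : L2 mu, N (A u) <= C * N u.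
(* modulo null functions, as integral operators are only linear in this sense *)
Hypothesis A_linear : forall (c : R) (u v : L2 mu), N (A (c *: u + v) - (c *: A u + A v)) = 0.

Lemma bounded_lip (u v : L2 mu) : N (A u - A v) <= C * N (u - v).
Proof.
have h := A_linear (-1) v u.
rewrite (_ : A u - A v = (-1 *: A v + A u - A (-1 *: v + u)) + A (-1 *: v + u)); last first.
  by rewrite subrK scaleN1r addrC.
rewrite (le_trans (L2normD _ _))// [X in X + _]L2normBC h add0r.
by rewrite (le_trans (A_bounded _))// scaleN1r addrC.
Qed.

Lemma A0_eq0 : N (A 0) = 0.
Proof.
have := A_bounded 0; rewrite L2norm0 mulr0 => h.
by apply/eqP; rewrite eq_le h L2norm_ge0.
Qed.

Definition exp_term (a : L2 mu) (t : R) (k : nat) : L2 mu :=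
  (t ^+ k / k`!%:R) *: iter k A a.

Definition exp_sum a t n : L2 mu := \sum_(k < n) exp_term a t k.

(** E t is exp (t A) a, which is determined only up to null functions. *)
Definition is_orbit (a : L2 mu) (E : R -> L2 mu) :=
  forall t, N (exp_sum a t n - E t) @[n --> \oo] --> (0 : R).

Lemma iter_bound a k : N (iter k A a) <= C ^+ k * N a.
Proof.
elim: k => [|k IH]; first by rewrite expr0 mul1r.
by rewrite iterS (le_trans (A_bounded _))// exprS -mulrA ler_wpM2l.
Qed.

Lemma exp_term_bound a t k : N (exp_term a t k) <= exp_coeff (C * `|t|) k * N a.
Proof.
rewrite L2normZ /exp_coeff/= normrM normrX normfV (ger0_norm (ler0n _ _)).
rewrite exprMn -!mulrA mulrC -!mulrA mulrC -!mulrA.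
rewrite [leRHS](_ : _ = `|t| ^+ k * (k`!%:R^-1 * (C ^+ k * N a))); last by ring.
rewrite [leLHS](_ : _ = `|t| ^+ k * (k`!%:R^-1 * N (iter k A a))); last by ring.
by rewrite ler_wpM2l ?exprn_ge0// ler_wpM2l ?invr_ge0// iter_bound.
Qed.

Lemma exp_sum_dist a t m n : (n <= m)%N ->
  N (exp_sum a t m - exp_sum a t n) <=
  (series (exp_coeff (C * `|t|)) m - series (exp_coeff (C * `|t|)) n) * N a.
Proof.
move=> nm; rewrite /exp_sum /series/= -!(big_mkord xpredT).
rewrite (big_cat_nat (n := n))//= [X in _ <= (X - _) * _](big_cat_nat (n := n))//=.
rewrite addrAC subrr add0r [X in X * _]addrAC subrr add0r.
rewrite (le_trans (L2norm_sum _ _))// mulr_suml; apply: ler_sum => k _.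
exact: exp_term_bound.
Qed.

Lemma exp_sum_bound a t n : N (exp_sum a t n) <= expR (C * `|t|) * N a.
Proof.
have /= := exp_sum_dist a t (leq0n n).
rewrite /exp_sum big_ord0 subr0 /series/= [X in _ - X]big_geq// subr0 => /le_trans; apply.
rewrite ler_wpM2r ?L2norm_ge0//.
apply: (nondecreasing_cvgn_le _ (is_cvg_series_exp_coeff (C * `|t|))).
apply: nondecreasing_series => k _ _; exact/exp_coeff_ge0/mulr_ge0.
Qed.

Lemma orbit_exists a : exists E, is_orbit a E.
Proof.
suff /choice[E EP] : forall t, exists u, N (exp_sum a t n - u) @[n --> \oo] --> (0 : R).
  by exists E.
move=> t; apply: L2_complete => e e0.
have Na : 0 < N a + 1 by rewrite ltr_wpDl ?L2norm_ge0.
have := is_cvg_series_exp_coeff (C * `|t|).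
set S := series _; set l := limn S => /cvgrPdist_le /(_ (e / 2 / (N a + 1))).
rewrite !divr_gt0// => /(_ isT) [n0 _ n0P]; exists n0.
have key m n : (n0 <= m)%N -> (n0 <= n)%N -> (n <= m)%N ->
    N (exp_sum a t m - exp_sum a t n) <= e.
  move=> mn0 nn0 nm; rewrite (le_trans (exp_sum_dist a t nm))//.
  rewrite (@le_trans _ _ (e / (N a + 1) * N a))//.
    rewrite ler_wpM2r ?L2norm_ge0//.
    rewrite (_ : _ - _ = (l - S n) - (l - S m)); last by rewrite /S; ring.
    rewrite (le_trans (ler_norm _))// (le_trans (ler_normB _ _))//.
    rewrite [leRHS](_ : _ = e / 2 / (N a + 1) + e / 2 / (N a + 1)).
      by apply: lerD; [exact: (n0P n)|exact: (n0P m)].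
    by rewrite -mulrDl -splitr.
  by rewrite mulrAC ler_pdivrMr// ler_wpM2l ?lerDl// ltW.
move=> m n mn0 nn0; have [nm|mn] := leqP n m; first exact: key.
by rewrite L2normBC; apply: key => //; exact: ltnW.
Qed.

Lemma orbit_bound a E t : is_orbit a E -> N (E t) <= expR (C * `|t|) * N a.
Proof.
move=> /(_ t) h; apply: le_cvg0 h _ => n;
  have := L2normD (E t - exp_sum a t n) (exp_sum a t n); rewrite subrK => /le_trans; apply.
by rewrite L2normBC lerD2l exp_sum_bound.
Qed.

Lemma orbit0 a E : is_orbit a E -> N (E 0 - a) = 0.
Proof.
move=> /(_ 0) h; rewrite L2normBC; apply/esym; apply: (cvg_unique _ h) => //.
apply: cvg_near_cst; exists 1%N => // -[//|n] _ /=.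
rewrite /exp_sum big_ord_recl big1 ?addr0 /exp_term/= ?expr0 ?fact0 ?divr1 ?scale1r// => i _.
by rewrite expr0n/= mul0r scale0r.
Qed.

Lemma A_exp_sum a t n : N (A (exp_sum a t n) - exp_sum (A a) t n) = 0.
Proof.
elim: n => [|n IH]; first by rewrite /exp_sum !big_ord0 subr0 A0_eq0.
apply/eqP; rewrite eq_le L2norm_ge0 andbT.
rewrite /exp_sum !big_ord_recr/= [\sum_(i < n) _ + _]addrC.
set c := t ^+ n / _; set w := \sum_(i < n) exp_term a t i.
have := L2dist_triangle (A (c *: iter n A a + w)) (c *: A (iter n A a) + A w)
  (\sum_(i < n) exp_term (A a) t i + exp_term (A a) t n).
rewrite A_linear add0r => /le_trans; apply.
by rewrite {2}/exp_term -/c -iterSr iterS [X in X - _]addrC [X in _ - X]addrC addrKA IH.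
Qed.

(** A is continuous, and maps the partial sums for a to those for A a. *)
Lemma orbit_A a E E' t : is_orbit a E -> is_orbit (A a) E' ->
  N (E' t - A (E t)) = 0.
Proof.
move=> /(_ t) h /(_ t) h'; apply/eqP; rewrite eq_le L2norm_ge0 andbT.
apply: (@le_cvg0 _ _ _ (fun n => N (exp_sum (A a) t n - E' t) + C * N (exp_sum a t n - E t))).
  rewrite -[X in _ --> X]addr0 -{2}(mulr0 C).
  by apply: cvgD => //; apply: cvgM => //; exact: cvg_cst.
move=> n; rewrite addr0.
rewrite (le_trans (L2dist_triangle _ (exp_sum (A a) t n) _))// L2normBC lerD2l.
  rewrite (le_trans (L2dist_triangle _ (A (exp_sum a t n)) _))// L2normBC A_exp_sum add0r.
  exact: bounded_lip.
Qed.

Lemma dot_exp_sum a t w :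
  (fun n => dot (exp_sum a t n) w) = pseries (fun k => dot (iter k A a) w / k`!%:R) t.
Proof.
apply/funext => n; rewrite /pseries/= /series/= dot_suml big_mkord.
by apply: eq_bigr => k _; rewrite dotZl; ring.
Qed.

Lemma cvg_orbit_dot a E t w : is_orbit a E ->
  pseries (fun k => dot (iter k A a) w / k`!%:R) t @ \oo --> dot (E t) w.
Proof.
move=> /(_ t) h; rewrite -dot_exp_sum.
apply: (@dot_cvg _ _ _ mu _ (fun=> w)) => //.
by rewrite subrr L2norm0; exact: cvg_cst.
Qed.

Lemma pseries_diffs_iter a w :
  pseries_diffs (fun k => dot (iter k A a) w / k`!%:R) =
  (fun k => dot (iter k A (A a)) w / k`!%:R).
Proof.
apply/funext => k; rewrite /pseries_diffs -iterSr factS natrM.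
have k0 : k.+1%:R != 0 :> R by rewrite pnatr_eq0.
have f0 : k`!%:R != 0 :> R by rewrite pnatr_eq0 -lt0n fact_gt0.
by rewrite invfM mulrCA; congr (_ * _); rewrite mulrA mulfV ?mul1r.
Qed.

(** t |-> <E t, w> is a power series converging everywhere, with coefficients
    <A^k a, w> / k!. Formal differentiation shifts them, that is, replaces a by
    A a. *)
Lemma orbit_derive a E E' w (t : R) : is_orbit a E -> is_orbit (A a) E' ->
  is_derive t (1 : R) (fun s => dot (E s) w) (dot (E' t) w).
Proof.
move=> h h'; have [E'' h''] := orbit_exists (A (A a)).
have tK : `|t| < `| `|t| + 1| by rewrite [ltRHS]ger0_norm ?ltrDl// addr_ge0.
have c1 := @cvg_orbit_dot _ _ (`|t| + 1) w h.
have c2 := @cvg_orbit_dot _ _ (`|t| + 1) w h'.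
have c3 := @cvg_orbit_dot _ _ (`|t| + 1) w h''.
have -> : (fun s => dot (E s) w) =
    (fun s => limn (pseries (fun k => dot (iter k A a) w / k`!%:R) s)).
  by apply/funext => s; rewrite (cvg_lim _ (@cvg_orbit_dot _ _ s w h)).
have -> : dot (E' t) w =
    limn (pseries (pseries_diffs (fun k => dot (iter k A a) w / k`!%:R)) t).
  by rewrite pseries_diffs_iter (cvg_lim _ (@cvg_orbit_dot _ _ t w h')).
apply: (@pseries_snd_diffs _ _ (`|t| + 1)) => //.
- by apply/cvg_ex; eexists; exact: c1.
- by rewrite pseries_diffs_iter; apply/cvg_ex; eexists; exact: c2.
- by rewrite !pseries_diffs_iter; apply/cvg_ex; eexists; exact: c3.
Qed.

(** The mean value theorem applies to the pairings t |-> <E t, w>; duality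
    gives back the norm. *)
Lemma orbit_lip a E (T : R) : 0 < T -> is_orbit a E ->
  exists2 G : R, 0 < G & forall s t : R, s \in `[0, T] -> t \in `[0, T] ->
    N (E s - E t) <= G * `|s - t|.
Proof.
move=> T0 h; have [E' h'] := orbit_exists (A a).
set G := expR (C * T) * N (A a).
have G0 : 0 <= G by rewrite mulr_ge0 ?expR_ge0 ?L2norm_ge0.
have GE (t : R) : t \in `[0, T] -> N (E' t) <= G.
  rewrite in_itv/= => /andP[t0 tT].
  rewrite (le_trans (orbit_bound t h'))// ler_wpM2r ?L2norm_ge0// ler_expR.
  by rewrite ler_wpM2l// ger0_norm.
exists (G + 1); first by rewrite ltr_wpDl.
have key (s t : R) : s \in `[0, T] -> t \in `[0, T] -> s < t ->
    N (E t - E s) <= G * (t - s).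
  move=> /itvccP[s0 sT] /itvccP[t0 tT] st.
  apply: L2norm_le_dot => [|w]; first by rewrite mulr_ge0// subr_ge0 ltW.
  have dE r : is_derive r (1 : R) (fun s => dot (E s) w) (dot (E' r) w).
    exact: orbit_derive.
  have [|r rst] := @MVT R (fun s => dot (E s) w) (fun r => dot (E' r) w) s t st (fun r _ =>
    dE r).
  - exact: derivable_within_continuous.
  - rewrite dotBl => ->.
    rewrite mulrAC ler_wpM2r ?subr_ge0 ?(ltW st)//.
    rewrite (le_trans (ler_norm _))// (le_trans (cauchy_schwarz _ _))//.
    rewrite ler_wpM2r ?L2norm_ge0// GE// in_itv/=.
    move: rst; rewrite in_itv/= => /andP[sr rt].
    by rewrite (le_trans s0 (ltW sr)) (le_trans (ltW rt) tT).
move=> s t sT tT; have [st|ts|->] := ltgtP s t.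
- rewrite L2normBC distrC (le_trans (key _ _ sT tT st))// gtr0_norm ?subr_gt0//.
  by rewrite ler_wpM2r ?subr_ge0 ?(ltW st)// lerDl.
- rewrite (le_trans (key _ _ tT sT ts))// gtr0_norm ?subr_gt0//.
  by rewrite ler_wpM2r ?subr_ge0 ?(ltW ts)// lerDl.
- by rewrite !subrr L2norm0 normr0 mulr0.
Qed.

End exponential.


(** * Existence for bounded linear evolutions *)

Section build_H1.
Context {disp} {X : measurableType disp} {R : realType}.
Variable mu : {measure set X -> \bar R}.
Local Notation N f := (L2norm mu (@Lfunction.sort _ _ _ mu _ (lee1n 2) f)).
Local Notation leb := (@lebesgue_measure R).

Definition lip_on (T : R) (u : R -> L2 mu) := exists2 G : R, 0 < G &
  forall s t : R, s \in `[0, T] -> t \in `[0, T] -> N (u s - u t) <= G * `|s - t|.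

Lemma lip_bounded (T : R) u : 0 < T -> lip_on T u ->
  exists2 B : R, 0 < B & forall t, t \in `[0, T] -> N (u t) <= B.
Proof.
move=> T0 [G G0 GP]; exists (N (u 0) + G * T).
  by rewrite ltr_wpDl ?L2norm_ge0 ?mulr_gt0.
move=> t tT; have [t0 t1] := itvccP tT.
have := L2normD (u t - u 0) (u 0); rewrite subrK => /le_trans; apply.
rewrite addrC lerD2l (le_trans (GP _ _ _ _))//.
  by rewrite in_itv/= lexx ltW.
by rewrite subr0 ger0_norm// ler_wpM2l// ltW.
Qed.

Lemma lip_ucont (T : R) u (phi : R -> R) : 0 < T -> lip_on T u -> continuous phi ->
  ucont T (fun t => phi t *: u t).
Proof.
move=> T0 /[dup] ul [G G0 GP] cphi e e0.
have [B B0 BP] := lip_bounded T0 ul.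
have [M M0 MP] : exists2 M : R, 0 < M & forall t, t \in `[0, T] -> `|phi t| <= M.
  have : {within `[0, T], continuous (fun t => `|phi t|)}.
    apply: continuous_subspaceT => t.
    by apply: continuous_comp; [exact: cphi|exact: norm_continuous].
  move=> /(EVT_max (ltW T0))[c cT cP]; exists (`|phi c| + 1).
    by rewrite ltr_wpDl.
  by move=> t tT; rewrite (le_trans (cP _ tT))// lerDl.
have e2B : 0 < e / 2 / B by rewrite !divr_gt0.
have [r1 r10 r1P] := heine_cantor T cphi e2B.
exists (Num.min r1 (e / 2 / (M * G))); first by rewrite lt_min r10 !divr_gt0// mulr_gt0.
move=> s t sT tT; rewrite le_min => /andP[st1 st2].
have -> : phi s *: u s - phi t *: u t = (phi s - phi t) *: u s + phi t *: (u s - u t).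
  by rewrite scalerBl scalerBr addrA subrK.
have := L2normD ((phi s - phi t) *: u s) (phi t *: (u s - u t)); rewrite !L2normZ.
move=> /le_trans; apply.
rewrite (splitr e); apply: lerD.
  rewrite (@le_trans _ _ (e / 2 / B * B))//; last by rewrite divfK// gt_eqF.
  by rewrite ler_pM ?L2norm_ge0// ?r1P ?BP.
rewrite (@le_trans _ _ (M * (G * (e / 2 / (M * G)))))//; last first.
  rewrite [leLHS](_ : _ = e / 2)//; field; by rewrite !gt_eqF.
rewrite ler_pM ?L2norm_ge0 ?MP// (le_trans (GP _ _ sT tT))//.
by rewrite ler_wpM2l// ltW.
Qed.

Lemma lip_cvg (T : R) u (t : R) : lip_on T u -> t \in `[0, T] ->
  N (u s - u t) @[s --> within [set` `[0, T]] (nbhs t)] --> (0 : R).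
Proof.
move=> [G G0 GP] tT; apply/cvgrPdist_le => e e0.
rewrite near_withinE.
have := nbhsx_ballx t _ (divr_gt0 e0 G0).
apply: filterS => s /ltW ts sT.
have -> : `|0 - N (u s - u t)| = N (u s - u t).
  by rewrite sub0r normrN ger0_norm ?L2norm_ge0.
by rewrite (le_trans (GP _ _ sT tT))// mulrC -ler_pdivlMr// distrC.
Qed.

Lemma lip_bochner_L2 (T : R) u : 0 < T -> lip_on T u -> bochner_L2 `[0, T] u.
Proof.
move=> T0 ul; split.
  apply: ucont_strongly_measurable => // e e0.
  have [G G0 GP] := ul; exists (e / G); first exact: divr_gt0.
  move=> s t sT tT st; rewrite (le_trans (GP _ _ sT tT))//.
  by rewrite mulrC -ler_pdivlMr.
have [B B0 BP] := lip_bounded T0 ul.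
apply: (@le_lt_trans _ _ (\int[leb]_(t in `[0%R, T]) (B ^+ 2)%:E)%E).
  apply: ae_ge0_le_lower_integral.
  - by move=> t _; rewrite lee_fin sqr_ge0.
  - by move=> t _; rewrite lee_fin sqr_ge0.
  - exists set0; split => // t /= /not_implyP[tT]; apply => {}.
    by rewrite lee_fin lerXn2r ?nnegrE ?L2norm_ge0 ?BP// ltW.
by rewrite integral_cst//= lebesgue_itv0// -EFinM ltry.
Qed.

Lemma bochner_ext (D : set R) (f : R -> L2 mu) I J : is_bochner_integral D f I ->
  N (I - J) = 0 -> is_bochner_integral D f J.
Proof.
move=> [sm [s [s0 sI]]] IJ; split=> //; exists s; split => //.
apply: (@squeeze_cvgr _ _ _ _ (cst 0) (fun k => N (sf_integral D (s k) - I))) => //.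
  apply: nearW => k; apply/andP; split; first exact: L2norm_ge0.
  by have := L2dist_triangle (sf_integral D (s k)) I J; rewrite IJ addr0.
exact: cvg_cst.
Qed.

(** For a test function phi, phi^`() u and phi g are uniformly continuous, so
    they have Bochner integrals. These are opposite because their pairings with
    each w are, by scalar integration by parts. *)
Lemma build_H1 (T : R) (u g : R -> L2 mu) : 0 < T -> lip_on T u -> lip_on T g ->
  (forall w (t : R), is_derive t (1 : R) (fun s => dot (u s) w) (dot (g t) w)) ->
  (forall w, continuous (fun t => dot (g t) w)) ->
  exists U : H1 mu T, H1_fun U = u /\ H1_deriv U = g.
Proof.
move=> T0 ul gl ug cg.
have wd : weak_derivative T u g.
  move=> phi tphi; have [dphi cphi _] := tphi.
  have cphi0 : continuous phi.
    by move=> t; apply: differentiable_continuous; apply/derivable1_diffP.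
  have [I HI] := ucont_bochner T0 (lip_ucont T0 ul cphi).
  have [J HJ] := ucont_bochner T0 (lip_ucont T0 gl cphi0).
  exists I; split => //; apply: (bochner_ext HJ).
  rewrite opprK; apply/eqP; rewrite eq_le L2norm_ge0 andbT.
  apply: L2norm_le_dot => // w; rewrite mul0r dotDl.
  have mD : measurable (`[0, T]%classic : set R) by exact: measurable_itv.
  have Doo : (leb `[0%R, T]%classic < +oo)%E by rewrite lebesgue_itv0// ltry.
  have cu : continuous (fun t => dot (u t) w).
    move=> t; apply: differentiable_continuous; apply/derivable1_diffP.
    by have := ug w t => -[].
  rewrite (@bochner_dot _ _ _ _ _ _ _ w (fun t =>
    (phi^`())%classic t * dot (u t) w) mD Doo HI); last 2 first.
  - apply: continuous_integrable0 => t.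
    by apply: continuousM; [exact: cphi|exact: cu].
  - by exists set0; split => // t /= /not_implyP[tT]; apply => {}; rewrite dotZl.
  rewrite (@bochner_dot _ _ _ _ _ _ _ w (fun t => phi t * dot (g t) w) mD Doo HJ);
    last 2 first.
  - apply: continuous_integrable0 => t.
    by apply: cvgM; [exact: cphi0|exact: cg].
  - by exists set0; split => // t /= /not_implyP[tT]; apply => {}; rewrite dotZl.
  by rewrite (parts_test T0 tphi (ug w) (cg w)) subrr.
exists (@MkH1 _ _ _ _ T u g (fun t tT =>
  lip_cvg ul tT) (lip_bochner_L2 T0 ul) (lip_bochner_L2 T0 gl) wd).
by [].
Qed.

End build_H1.

Section existence.
Context {disp} {X : measurableType disp} {R : realType}.
Variable mu : {measure set X -> \bar R}.
Local Notation N f := (L2norm mu (@Lfunction.sort _ _ _ mu _ (lee1n 2) f)).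

(** The derivative of the orbit of a is the orbit of A a, which is A applied to
    the orbit of a. *)
Lemma linear_evolution_exists (A : L2 mu -> L2 mu) (C T : R) (a : L2 mu) :
  0 <= C -> (forall u : L2 mu, N (A u) <= C * N u) ->
  (forall (c : R) (u v : L2 mu), N (A (c *: u + v) - (c *: A u + A v)) = 0) ->
  0 < T ->
  exists U : H1 mu T, [/\ N (U 0 - a) = 0 &
    forall t, N (H1_deriv U t - A (U t)) = 0].
Proof.
move=> C0 Ab Al T0.
have [E hE] := orbit_exists C0 Ab a.
have [E' hE'] := orbit_exists C0 Ab (A a).
have [E'' hE''] := orbit_exists C0 Ab (A (A a)).
have El := orbit_lip C0 Ab T0 hE.
have E'l := orbit_lip C0 Ab T0 hE'.
have dE w (t : R) := orbit_derive C0 Ab w t hE hE'.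
have cE' w : continuous (fun t => dot (E' t) w).
  move=> t; apply: differentiable_continuous; apply/derivable1_diffP.
  by have := orbit_derive C0 Ab w t hE' hE'' => -[].
have [U [UE UE']] := build_H1 T0 El E'l dE cE'.
exists U; rewrite UE UE'; split; first exact: orbit0 hE.
by move=> t; apply: (@orbit_A _ _ _ _ A C).
Qed.

End existence.

(** * Weak differential inequalities *)

Section smooth_step.
Context {R : realType}.
Local Notation leb := (@lebesgue_measure R).
Implicit Types (x k s t r : R).

Lemma is_derive_quadratic (f : R -> R) x (l c : R) :
  (forall h, `|f (x + h) - f x - l * h| <= c * h ^+ 2) ->
  is_derive x (1 : R) f l.
Proof.
move=> fq.
have fl : (fun h => h^-1 *: (f (h *: (1 : R) + x) - f x)) @ 0^' --> l.
  apply/cvgrPdist_le => e e0.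
  have c0 : 0 <= c.
    by have := fq 1; rewrite expr1n [c * 1]mulr1; exact: (le_trans (normr_ge0 _)).
  have c1 : 0 < c + 1 by rewrite ltr_wpDl.
  near=> h.
  have h0 : h != 0 by near: h; exact: nbhs_dnbhs_neq.
  have hq := fq h.
  have -> : h *: (1 : R) + x = x + h by rewrite addrC; congr (x + _); exact: mulr1.
  rewrite -[_ *: _]/(h^-1 * (f (x + h) - f x)).
  rewrite (_ : l - _ = - (h^-1 * (f (x + h) - f x - l * h))); last by field.
  rewrite normrN normrM normfV mulrC ler_pdivrMr ?normr_gt0//.
  rewrite (le_trans hq)// -real_normK ?num_real// expr2 mulrA ler_wpM2r//.
  have hd : `|h| <= e / (c + 1).
    by near: h; apply: dnbhs0_le; exact: divr_gt0.
  rewrite (le_trans (ler_wpM2l c0 hd))// mulrCA ler_piMr ?(ltW e0)//.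
  by rewrite ler_pdivrMr// mul1r lerDl.
split; first by apply/cvg_ex; exists l; exact: fl.
exact: (cvg_lim _ fl).
Unshelve. all: end_near. Qed.

Definition pos_part x : R := Num.max x 0.

Lemma pos_partP x : (x <= 0 /\ pos_part x = 0) \/ (0 <= x /\ pos_part x = x).
Proof.
rewrite /pos_part; case: (leP x 0) => x0; [left|right]; split => //; exact: ltW.
Qed.

(** A quadratic spline: it is C1, increases from 0 to 1 on [-1, 1], and its
    derivative is the tent function of [-1, 1]. *)
Definition smooth_step x : R :=
  (pos_part (x + 1) ^+ 2 - 2 * pos_part x ^+ 2 + pos_part (x - 1) ^+ 2) / 2.

Definition tent x : R := pos_part (x + 1) - 2 * pos_part x + pos_part (x - 1).

Lemma smooth_step_le x : x <= -1 -> smooth_step x = 0.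
Proof.
rewrite /smooth_step => x1.
have [[a ->]|[a ->]] := pos_partP (x + 1); have [[b ->]|[b ->]] := pos_partP x;
  have [[c ->]|[c ->]] := pos_partP (x - 1); nra.
Qed.

Lemma smooth_step_ge x : 1 <= x -> smooth_step x = 1.
Proof.
rewrite /smooth_step => x1.
have [[a ->]|[a ->]] := pos_partP (x + 1); have [[b ->]|[b ->]] := pos_partP x;
  have [[c ->]|[c ->]] := pos_partP (x - 1); nra.
Qed.

Lemma smooth_step_itv x : 0 <= smooth_step x <= 1.
Proof.
rewrite /smooth_step; apply/andP; split.
- have [[a ->]|[a ->]] := pos_partP (x + 1); have [[b ->]|[b ->]] := pos_partP x;
  have [[c ->]|[c ->]] := pos_partP (x - 1); nra.
- have [[a ->]|[a ->]] := pos_partP (x + 1); have [[b ->]|[b ->]] := pos_partP x;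
  have [[c ->]|[c ->]] := pos_partP (x - 1); nra.
Qed.

Lemma tent_ge0 x : 0 <= tent x.
Proof.
rewrite /tent.
have [[a ->]|[a ->]] := pos_partP (x + 1); have [[b ->]|[b ->]] := pos_partP x;
  have [[c ->]|[c ->]] := pos_partP (x - 1); lra.
Qed.

Lemma tent_eq0 x : 1 <= `|x| -> tent x = 0.
Proof.
rewrite /tent real_ler_normr ?num_real//.
have [[a ->]|[a ->]] := pos_partP (x + 1); have [[b ->]|[b ->]] := pos_partP x;
  have [[c ->]|[c ->]] := pos_partP (x - 1) => /orP[x1|x1]; lra.
Qed.

Lemma pos_part_quadratic x k :
  `|pos_part (x + k) ^+ 2 - pos_part x ^+ 2 - 2 * pos_part x * k| <= k ^+ 2.
Proof.
rewrite ler_norml; apply/andP; split.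
- have [[a ->]|[a ->]] := pos_partP (x + k); have [[b ->]|[b ->]] := pos_partP x; nra.
- have [[a ->]|[a ->]] := pos_partP (x + k); have [[b ->]|[b ->]] := pos_partP x; nra.
Qed.

Lemma smooth_step_quadratic x k :
  `|smooth_step (x + k) - smooth_step x - tent x * k| <= 2 * k ^+ 2.
Proof.
have h1 := pos_part_quadratic (x + 1) k.
have h2 := pos_part_quadratic x k.
have h3 := pos_part_quadratic (x - 1) k.
rewrite /smooth_step /tent [x + k + 1]addrAC [x + k - 1]addrAC.
move: h1 h2 h3; rewrite !ler_norml => /andP[a1 a2] /andP[b1 b2] /andP[c1 c2].
apply/andP; split; lra.
Qed.

Lemma continuous_pos_part : continuous pos_part.
Proof. by move=> x; apply: continuous_max; [exact: cvg_id|exact: cvg_cst]. Qed.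

Lemma continuous_tent : continuous tent.
Proof.
move=> x.
have c y : {for x, continuous (fun z => pos_part (z + y))}.
  apply: (@continuous_comp _ _ _ (fun z => z + y) pos_part); last exact: continuous_pos_part.
  by apply: cvgD; [exact: cvg_id|exact: cvg_cst].
apply: cvgD (c (-1)); apply: cvgB (c 1) _.
by apply: cvgM; [exact: cvg_cst|exact: continuous_pos_part].
Qed.

Definition step_at e s r : R := smooth_step ((r - s) / e).
Definition bump_at e s r : R := tent ((r - s) / e) / e.

Lemma step_at_derive e s r : 0 < e -> is_derive r (1 : R) (step_at e s) (bump_at e s r).
Proof.
move=> e0; apply: (@is_derive_quadratic _ _ _ (2 / e ^+ 2)) => h.
have := smooth_step_quadratic ((r - s) / e) (h / e).
rewrite /step_at /bump_at (_ : (r + h - s) / e = (r - s) / e + h / e);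
  last by rewrite -mulrDl addrAC.
rewrite [tent _ * (h / e)](_ : _ = tent ((r - s) / e) / e * h); last by rewrite mulrA mulrAC.
by rewrite expr_div_n [2 / e ^+ 2 * _]mulrAC mulrA.
Qed.

Lemma bump_at_ge0 e s r : 0 < e -> 0 <= bump_at e s r.
Proof. by move=> e0; rewrite divr_ge0 ?tent_ge0// ltW. Qed.

Lemma bump_at_eq0 e s r : 0 < e -> e <= `|r - s| -> bump_at e s r = 0.
Proof.
move=> e0 es; rewrite /bump_at tent_eq0 ?mul0r// normrM normfV (gtr0_norm e0).
by rewrite ler_pdivlMr// mul1r.
Qed.

Lemma continuous_bump_at e s : continuous (bump_at e s).
Proof.
move=> r; apply: cvgM; last exact: cvg_cst.
apply: (@continuous_comp _ _ _ (fun y => (y - s) / e) tent); last exact: continuous_tent.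
apply: cvgM; last exact: cvg_cst.
by apply: cvgD; [exact: cvg_id|exact: cvg_cst].
Qed.

Lemma integral_bump_at (T e s : R) : 0 < e -> e <= s -> s + e <= T ->
  \int[leb]_(r in `[0, T]) bump_at e s r = 1.
Proof.
move=> e0 es seT.
have T0 : 0 < T by lra.
have dS r : is_derive r (1 : R) (step_at e s) (bump_at e s r) by exact: step_at_derive.
have h1 : {within `[0, T], continuous (bump_at e s)}.
  by apply: continuous_subspaceT; exact: continuous_bump_at.
have h2 : derivable_oo_LRcontinuous (step_at e s) 0 T.
  by apply: derivable_LRcontinuous => t; have := dS t => -[].
have h3 : {in `]0, T[, ((step_at e s)^`())%classic =1 bump_at e s}.
  by move=> t _; rewrite derive1E derive_val.
rewrite /Rintegral (continuous_FTC2 T0 h1 h2 h3) /step_at -EFinB/=.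
rewrite smooth_step_ge ?smooth_step_le ?subr0//.
  by rewrite ler_pdivrMr// mulN1r sub0r lerN2.
by rewrite ler_pdivlMr// mul1r; lra.
Qed.

Lemma test_function_steps (T e s t : R) : 0 < e -> e < s -> s < t -> t + e < T ->
  test_function T (fun r => step_at e s r - step_at e t r) /\
  (forall r, ((fun r => step_at e s r - step_at e t r)^`())%classic r =
     bump_at e s r - bump_at e t r).
Proof.
move=> e0 es st teT.
have dP r : is_derive r (1 : R) (fun r =>
  step_at e s r - step_at e t r) (bump_at e s r - bump_at e t r).
  by apply: is_deriveB; exact: step_at_derive.
have dE r : ((fun r => step_at e s r - step_at e t r)^`())%classic r =
     bump_at e s r - bump_at e t r.
  by rewrite derive1E derive_val.
split => //; split.
- by move=> r; have := dP r => -[].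
- rewrite (_ : _^`()%classic = fun r => bump_at e s r - bump_at e t r); last exact/funext.
  by move=> r; apply: cvgB; exact: continuous_bump_at.
- exists (s - e), (t + e); split => //; first by lra.
  move=> r; rewrite in_itv/= negb_and -!ltNge => /orP[rs|rt]; rewrite /step_at.
    by rewrite !smooth_step_le ?subrr// ler_pdivrMr//; lra.
  by rewrite !smooth_step_ge ?subrr// ler_pdivlMr//; lra.
Qed.

End smooth_step.

Section weak_inequality.
Context {R : realType}.
Local Notation leb := (@lebesgue_measure R).
Implicit Types (f g h b p : R -> R).

Definition cont_on (T : R) f := forall t, t \in `[0, T] ->
  f s @[s --> within [set` `[0, T]] (nbhs t)] --> f t.

Lemma cont_on_within (T : R) f : cont_on T f -> {within `[0, T], continuous f}.
Proof. by move=> cf; apply/subspace_continuousP => t tT; exact: cf. Qed.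

Lemma cont_on_integrable (T : R) f : cont_on T f -> leb.-integrable `[0, T] (EFin \o f).
Proof.
move=> cf; apply: continuous_compact_integrable; first exact: segment_compact.
exact: cont_on_within.
Qed.

Lemma cont_on_continuous (T : R) f : continuous f -> cont_on T f.
Proof. by move=> cf t _; apply: cvg_within_filter; exact: cf. Qed.

Lemma cont_on_mul (T : R) f g : cont_on T f -> cont_on T g ->
  cont_on T (fun t => f t * g t).
Proof. by move=> cf cg t tT; apply: cvgM; [exact: cf|exact: cg]. Qed.

Lemma cont_on_sub (T : R) f g : cont_on T f -> cont_on T g ->
  cont_on T (fun t => f t - g t).
Proof. by move=> cf cg t tT; apply: cvgB; [exact: cf|exact: cg]. Qed.

Lemma cont_on_near (T : R) f t (e : R) : cont_on T f -> t \in `[0, T] -> 0 < e ->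
  exists2 r : R, 0 < r & forall s, s \in `[0, T] -> `|s - t| < r -> `|f s - f t| <= e.
Proof.
move=> cf tT e0; have /cvgrPdist_le /(_ e e0) := cf t tT.
rewrite near_withinE => -[r /= r0 rP]; exists r => // s sT st.
by rewrite distrC; apply: rP => //=; rewrite distrC.
Qed.

(** A test function that climbs from 0 to 1 near s and goes down again near t has
    for derivative a bump at s minus a bump at t. The hypothesis then compares the
    averages of p over small neighbourhoods of s and of t. *)
Lemma nonincreasing_of_tests (T : R) p : cont_on T p ->
  (forall phi, test_function T phi -> (forall r, 0 <= phi r) ->
     0 <= \int[leb]_(r in `[0, T]) ((phi^`())%classic r * p r)) ->
  forall s t : R, 0 < s -> s < t -> t < T -> p t <= p s.
Proof.
move=> cp pos s t s0 st tT; apply/ler_addgt0Pr => e e0.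
have e20 : 0 < e / 2 by rewrite divr_gt0.
have sT' : s \in `[0, T] by rewrite in_itv/=; apply/andP; split; lra.
have tT' : t \in `[0, T] by rewrite in_itv/=; apply/andP; split; lra.
have [r1 r10 r1P] := cont_on_near cp sT' e20.
have [r2 r20 r2P] := cont_on_near cp tT' e20.
pose m := Num.min (Num.min r1 r2) (Num.min s (Num.min (T - t) (t - s))).
have m0 : 0 < m by rewrite !lt_min r10 r20 s0 !subr_gt0 tT st.
have [mr1 mr2 ms mT mst] : [/\ m <= r1, m <= r2, m <= s, m <= T - t & m <= t - s].
  by rewrite /m !ge_min !lexx !orbT.
pose d := m / 2.
have d0 : 0 < d by rewrite divr_gt0.
have dm : d * 2 = m by rewrite divfK.
have [tf dtf] : test_function T (fun r => step_at d s r - step_at d t r) /\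
  (forall r, ((fun r => step_at d s r - step_at d t r)^`())%classic r =
     bump_at d s r - bump_at d t r).
  by apply: test_function_steps => //; lra.
have phi0 r : 0 <= step_at d s r - step_at d t r.
  have /andP[a1 a2] := smooth_step_itv ((r - s) / d).
  have /andP[b1 b2] := smooth_step_itv ((r - t) / d).
  have [rt|rt] := leP (r - t) (- d).
    by rewrite /step_at [X in _ - X]smooth_step_le ?subr0// ler_pdivrMr// mulN1r.
  rewrite /step_at [X in X - _]smooth_step_ge ?subr_ge0//.
  by rewrite ler_pdivlMr// mul1r; lra.
have := pos _ tf phi0.
have mD : measurable (`[0, T]%classic : set R) by exact: measurable_itv.
have ib u : leb.-integrable `[0, T] (EFin \o bump_at d u).
  by apply: continuous_integrable0; exact: continuous_bump_at.
have ibp u : leb.-integrable `[0, T] (EFin \o (fun r => bump_at d u r * p r)).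
  apply: cont_on_integrable; apply: cont_on_mul => //.
  by apply: cont_on_continuous; exact: continuous_bump_at.
have ibc u c : leb.-integrable `[0, T] (EFin \o (fun r => bump_at d u r * c)).
  apply: continuous_integrable0 => x; apply: cvgM; last exact: cvg_cst.
  exact: continuous_bump_at.
under eq_Rintegral do rewrite dtf mulrBl.
rewrite RintegralB//.
have Is c : \int[leb]_(r in `[0, T]) (bump_at d s r * c) = c.
  by rewrite RintegralZr// integral_bump_at ?mul1r//; lra.
have It c : \int[leb]_(r in `[0, T]) (bump_at d t r * c) = c.
  by rewrite RintegralZr// integral_bump_at ?mul1r//; lra.
have le1 : \int[leb]_(r in `[0, T]) (bump_at d s r * p r) <= p s + e / 2.
  rewrite -[leRHS]Is; apply: le_Rintegral => //.
  move=> r rT; have [rd|rd] := leP d `|r - s|; first by rewrite bump_at_eq0// !mul0r.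
  rewrite ler_wpM2l ?bump_at_ge0//.
  have := r1P r rT; rewrite ler_norml => /(_ _)/andP[|_]; last by lra.
  by apply: lt_le_trans rd _; lra.
have le2 : p t - e / 2 <= \int[leb]_(r in `[0, T]) (bump_at d t r * p r).
  rewrite -[leLHS]It; apply: le_Rintegral => //.
  move=> r rT; have [rd|rd] := leP d `|r - t|; first by rewrite bump_at_eq0// !mul0r.
  rewrite ler_wpM2l ?bump_at_ge0//.
  have := r2P r rT; rewrite ler_norml => /(_ _)/andP[|? _]; last by lra.
  by apply: lt_le_trans rd _; lra.
lra.
Qed.

Lemma nonincreasing_closure (T : R) p : cont_on T p ->
  (forall s t : R, 0 < s -> s < t -> t < T -> p t <= p s) ->
  forall s t : R, 0 <= s -> s <= t -> t <= T -> p t <= p s.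
Proof.
move=> cp pd s t s0; rewrite le_eqVlt => /predU1P[<-//|st] tT.
apply/ler_addgt0Pr => e e0.
have e20 : 0 < e / 2 by rewrite divr_gt0.
have sT' : s \in `[0, T] by rewrite in_itv/=; apply/andP; split; lra.
have tT' : t \in `[0, T] by rewrite in_itv/=; apply/andP; split; lra.
have [r1 r10 r1P] := cont_on_near cp sT' e20.
have [r2 r20 r2P] := cont_on_near cp tT' e20.
pose m := Num.min (Num.min r1 r2) (t - s).
have m0 : 0 < m by rewrite !lt_min r10 r20 !subr_gt0 st.
have [mr1 mr2 mst] : [/\ m <= r1, m <= r2 & m <= t - s].
  by rewrite /m !ge_min !lexx !orbT.
pose d := m / 4.
have dm : d * 4 = m by rewrite divfK.
have := pd (s + d) (t - d); have := r1P (s + d); have := r2P (t - d).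
rewrite addrAC subrr add0r addrAC subrr add0r normrN gtr0_norm; last by lra.
move=> h1 h2 h3.
have a1 : `|p (t - d) - p t| <= e / 2.
  by apply: h1; [rewrite in_itv/=; apply/andP; split; lra|lra].
have a2 : `|p (s + d) - p s| <= e / 2.
  by apply: h2; [rewrite in_itv/=; apply/andP; split; lra|lra].
have a3 : p (t - d) <= p (s + d) by apply: h3; lra.
by move: a1 a2; rewrite !ler_norml => /andP[? ?] /andP[? ?]; lra.
Qed.

(** If h is the weak derivative of f, then h - b' <= 0 is that of f - b, which is
    therefore nonincreasing. *)
Lemma weak_comparison (T : R) f h b (b' : R -> R) : 0 < T -> cont_on T f -> cont_on T h ->
  (forall phi, test_function T phi ->
     \int[leb]_(r in `[0, T]) ((phi^`())%classic r * f r) =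
     - \int[leb]_(r in `[0, T]) (phi r * h r)) ->
  (forall r : R, is_derive r (1 : R) b (b' r)) -> continuous b' ->
  (forall r, r \in `[0, T] -> h r <= b' r) ->
  forall s t : R, 0 <= s -> s <= t -> t <= T -> f t - f s <= b t - b s.
Proof.
move=> T0 cf ch wd db cb' hb s t s0 st tT.
have cb : continuous b.
  move=> x; apply: differentiable_continuous; apply/derivable1_diffP.
  by have := db x => -[].
have cp : cont_on T (fun r => f r - b r).
  by apply: cont_on_sub => //; exact: cont_on_continuous.
have mD : measurable (`[0, T]%classic : set R) by exact: measurable_itv.
suff : f t - b t <= f s - b s by lra.
apply: (nonincreasing_closure cp _ s0 st tT) => {s t s0 st tT}.
apply: nonincreasing_of_tests => // phi tphi phi0.
have [dphi cphi' _] := tphi.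
have cphi : continuous phi.
  by move=> x; apply: differentiable_continuous; apply/derivable1_diffP.
have i1 : leb.-integrable `[0, T] (EFin \o (fun r => (phi^`())%classic r * f r)).
  by apply: cont_on_integrable; apply: cont_on_mul => //; exact: cont_on_continuous.
have i2 : leb.-integrable `[0, T] (EFin \o (fun r => (phi^`())%classic r * b r)).
  by apply: cont_on_integrable; apply: cont_on_mul => //; exact: cont_on_continuous.
have i3 : leb.-integrable `[0, T] (EFin \o (fun r => phi r * h r)).
  by apply: cont_on_integrable; apply: cont_on_mul => //; exact: cont_on_continuous.
have i4 : leb.-integrable `[0, T] (EFin \o (fun r => phi r * b' r)).
  by apply: cont_on_integrable; apply: cont_on_mul => //; exact: cont_on_continuous.
under eq_Rintegral do rewrite mulrBr.
rewrite RintegralB//.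
rewrite wd// (parts_test T0 tphi db cb') opprK addrC subr_ge0.
by apply: le_Rintegral => // r rT; rewrite ler_wpM2l// hb.
Qed.

End weak_inequality.

(** * Stability of evolutions *)

Section stability.
Context {disp} {X : measurableType disp} {R : realType}.
Variable mu : {measure set X -> \bar R}.
Local Notation N f := (L2norm mu (@Lfunction.sort _ _ _ mu _ (lee1n 2) f)).
Local Notation leb := (@lebesgue_measure R).

Definition evolves (T : R) (A : L2 mu -> L2 mu) (v : H1 mu T) :=
  {ae leb, forall t, t \in `]0, T[ -> N (H1_deriv v t - A (v t)) = 0}.

Definition lipschitz_op (A : L2 mu -> L2 mu) (C : R) :=
  forall u v : L2 mu, N (A u - A v) <= C * N (u - v).

Lemma squeeze_within (T t : R) (f g : R -> R) :
  (forall s, 0 <= f s <= g s) ->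
  g s @[s --> within [set` `[0, T]] (nbhs t)] --> (0 : R) ->
  f s @[s --> within [set` `[0, T]] (nbhs t)] --> (0 : R).
Proof.
move=> fg g0; apply: (@squeeze_cvgr _ _ _ _ (cst 0) g) => //.
  exact: nearW.
exact: cvg_cst.
Qed.

Lemma cont_on_dot (T : R) (v : R -> L2 mu) (w : L2 mu) :
  (forall t, t \in `[0, T] ->
    N (v s - v t) @[s --> within [set` `[0, T]] (nbhs t)] --> (0 : R)) ->
  cont_on T (fun t => dot (v t) w).
Proof.
move=> cv t tT; apply/subr_cvg0; apply/norm_cvg0P.
apply: (@squeeze_within _ _ _ (fun s => N (v s - v t) * N w)).
  move=> s; rewrite normr_ge0/= -/(dot _ _).
  by have := cauchy_schwarz (v s - v t) w; rewrite dotBl.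
rewrite -[X in _ --> X](mul0r (N w)); apply: cvgM; [exact: cv|exact: cvg_cst].
Qed.

Lemma cont_on_norm (T : R) (v : R -> L2 mu) :
  (forall t, t \in `[0, T] ->
    N (v s - v t) @[s --> within [set` `[0, T]] (nbhs t)] --> (0 : R)) ->
  cont_on T (fun t => N (v t)).
Proof.
move=> cv t tT; apply/subr_cvg0; apply/norm_cvg0P.
apply: (@squeeze_within _ _ _ (fun s => N (v s - v t))); last exact: cv.
move=> s; rewrite normr_ge0/=; exact: L2norm_dist.
Qed.

Lemma cvg_norm_sub (T t : R) (v1 v2 : R -> L2 mu) :
  N (v1 s - v1 t) @[s --> within [set` `[0, T]] (nbhs t)] --> (0 : R) ->
  N (v2 s - v2 t) @[s --> within [set` `[0, T]] (nbhs t)] --> (0 : R) ->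
  N ((v1 s - v2 s) - (v1 t - v2 t)) @[s --> within [set` `[0, T]] (nbhs t)] --> (0 : R).
Proof.
move=> c1 c2; apply: (@squeeze_within _ _ _ (fun s => N (v1 s - v1 t) + N (v2 s - v2 t))).
  move=> s; apply/andP; split; first exact: L2norm_ge0.
  rewrite (_ : v1 s - v2 s - (v1 t - v2 t) = (v1 s - v1 t) - (v2 s - v2 t)); last first.
    by rewrite !opprD addrACA.
  exact: L2normB.
by rewrite -[X in _ --> X](addr0 0); apply: cvgD.
Qed.

Lemma cvg_norm_lip (T t : R) (A : L2 mu -> L2 mu) (C : R) (v : R -> L2 mu) :
  lipschitz_op A C ->
  N (v s - v t) @[s --> within [set` `[0, T]] (nbhs t)] --> (0 : R) ->
  N (A (v s) - A (v t)) @[s --> within [set` `[0, T]] (nbhs t)] --> (0 : R).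
Proof.
move=> AC c; apply: (@squeeze_within _ _ _ (fun s => C * N (v s - v t))).
  by move=> s; rewrite L2norm_ge0/=; exact: AC.
by rewrite -[X in _ --> X](mulr0 C); apply: cvgM => //; exact: cvg_cst.
Qed.

Lemma H1_cvg (T t : R) (v : H1 mu T) : t \in `[0, T] ->
  N (v s - v t) @[s --> within [set` `[0, T]] (nbhs t)] --> (0 : R).
Proof. exact: H1_continuous. Qed.

(** The equation identifies the weak derivative of <v, w> with <A v, w>, which,
    unlike <H1_deriv v, w>, is known to be continuous. *)
Lemma evolves_weak (T : R) (A : L2 mu -> L2 mu) (C : R) (v : H1 mu T) (w : L2 mu) :
  0 < T -> lipschitz_op A C -> evolves A v ->
  forall phi, test_function T phi ->
    \int[leb]_(t in `[0, T]) ((phi^`())%classic t * dot (v t) w) =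
    - \int[leb]_(t in `[0, T]) (phi t * dot (A (v t)) w).
Proof.
move=> T0 AC ev phi tphi.
have [I [I1 I2]] := H1_weak_derivative v tphi.
have [dphi cphi' [a [b [a0 bT phi0]]]] := tphi.
have cphi : continuous phi.
  by move=> x; apply: differentiable_continuous; apply/derivable1_diffP.
have mD : measurable (`[0, T]%classic : set R) by exact: measurable_itv.
have Doo : (leb `[0%R, T]%classic < +oo)%E by rewrite lebesgue_itv0// ltry.
rewrite -(@bochner_dot _ _ _ _ _ _ _ w (fun t =>
  (phi^`())%classic t * dot (v t) w) mD Doo I1); last 2 first.
- apply: cont_on_integrable; apply: cont_on_mul.
    exact: cont_on_continuous.
  by apply: cont_on_dot => t; exact: H1_cvg.
- by exists set0; split => // t /= /not_implyP[tT]; apply => {}; rewrite dotZl.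
rewrite -(@bochner_dot _ _ _ _ _ _ _ w (fun t => phi t * dot (A (v t)) w) mD Doo I2).
- by rewrite dotNl opprK.
- apply: cont_on_integrable; apply: cont_on_mul.
    exact: cont_on_continuous.
  apply: cont_on_dot => t tT; apply: cvg_norm_lip AC _; exact: H1_cvg.
- apply: ae_lebesgueS ev => t h tT; rewrite dotZl.
  have [t0T|t0T] := boolP (t \in `]0, T[).
    congr (_ * _); apply/eqP; rewrite -subr_eq0 -dotBl -normr_le0.
    by rewrite (le_trans (cauchy_schwarz _ _))// h// mul0r.
  rewrite phi0 ?mul0r//; apply: contra t0T; rewrite !in_itv/= => /andP[ta tb].
  by apply/andP; split; lra.
Qed.

(** Gronwall's inequality. Let c be a maximum point of exp (-2 C t) N (d t), with
    d = v1 - v2, and Q the maximum. The pairing f of d with the fixed vector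
    w = d c has derivative at most N w (C Q exp (2 C t) + e B); integrating from 0
    to c bounds N w = Q exp (2 C c) by half of itself plus the data. The factor 2
    in the exponent is what makes the self-referential term absorbable. *)
Lemma evolves_stability (T : R) (A1 A2 : L2 mu -> L2 mu) (C C2 e B : R)
    (v1 v2 : H1 mu T) : 0 < T -> 0 < C -> 0 <= e -> 0 <= B ->
  lipschitz_op A1 C -> lipschitz_op A2 C2 ->
  (forall u : L2 mu, N (A1 u - A2 u) <= e * N u) ->
  evolves A1 v1 -> evolves A2 v2 ->
  (forall t, t \in `[0, T] -> N (v2 t) <= B) ->
  forall t, t \in `[0, T] ->
    N (v1 t - v2 t) <= (N (v1 0 - v2 0) + e * B * T) * expR (2 * C * T).
Proof.
move=> T0 C0 e0 B0 A1C A2C A12 ev1 ev2 vB.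
pose d t : L2 mu := v1 t - v2 t.
have cd t : t \in `[0, T] ->
    N (d s - d t) @[s --> within [set` `[0, T]] (nbhs t)] --> (0 : R).
  by move=> tT; apply: cvg_norm_sub; exact: H1_cvg.
pose E t : R := expR (2 * C * t).
have dE t : is_derive t (1 : R) E (2 * C * E t).
  have dl : is_derive t (1 : R) (fun x => 2 * C * x) (2 * C).
    have := is_deriveZ (2 * C) (is_derive_id t (1 : R)).
    by rewrite /GRing.scale/= mulr1.
  have := is_derive1_comp (is_derive_expR (2 * C * t)) dl.
  by rewrite [X in is_derive _ _ _ X]mulrC.
have cE : continuous E.
  by move=> x; apply: differentiable_continuous; apply/derivable1_diffP; have := dE x => -[].
have E0 t : 0 < E t by exact: expR_gt0.
pose q t := N (d t) * (E t)^-1.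
have cq : cont_on T q.
  apply: cont_on_mul; first exact: cont_on_norm.
  apply: cont_on_continuous => x; apply: cvgV; first by rewrite gt_eqF.
  exact: cE.
have [c cT qmax] := EVT_max (ltW T0) (cont_on_within cq).
set Q := q c in qmax.
have dQ t : t \in `[0, T] -> N (d t) <= Q * E t.
  by move=> tT; rewrite -ler_pdivrMr//; exact: qmax.
have Q0 : 0 <= Q by rewrite mulr_ge0 ?L2norm_ge0// invr_ge0 ltW.
pose w := d c.
have wE : N w = Q * E c by rewrite /Q /q divfK// gt_eqF.
have [c0 cT'] := itvccP cT.
suff QB : Q <= N (d 0) + e * B * T.
  move=> t tT; rewrite (le_trans (dQ t tT))//.
  have [t0 tT'] := itvccP tT.
  rewrite ler_pM ?(ltW (E0 _))// ler_expR ler_wpM2l//.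
  by rewrite mulr_ge0// ltW.
have [w0|w0] := eqVneq (N w) 0.
  rewrite (_ : Q = 0).
    by rewrite addr_ge0 ?L2norm_ge0// !mulr_ge0// ltW.
  by rewrite /Q /q -/w w0 mul0r.
have Nw0 : 0 < N w by rewrite lt_neqAle eq_sym w0 L2norm_ge0.
pose f t := dot (d t) w.
pose h t := dot (A1 (v1 t)) w - dot (A2 (v2 t)) w.
pose b t := N w * (Q / 2 * E t + e * B * t).
pose b' t := N w * (Q / 2 * (2 * C * E t) + e * B).
have cf : cont_on T f by exact: cont_on_dot.
have cv1 t : t \in `[0, T] -> N (A1 (v1 s) - A1 (v1 t))
  @[s --> within [set` `[0, T]] (nbhs t)] --> (0 : R).
  by move=> tT; apply: cvg_norm_lip A1C _; exact: H1_cvg.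
have cv2 t : t \in `[0, T] -> N (A2 (v2 s) - A2 (v2 t))
  @[s --> within [set` `[0, T]] (nbhs t)] --> (0 : R).
  by move=> tT; apply: cvg_norm_lip A2C _; exact: H1_cvg.
have ch : cont_on T h.
  by apply: cont_on_sub; exact: cont_on_dot.
have mD : measurable (`[0, T]%classic : set R) by exact: measurable_itv.
have wd phi : test_function T phi ->
     \int[leb]_(r in `[0, T]) ((phi^`())%classic r * f r) =
     - \int[leb]_(r in `[0, T]) (phi r * h r).
  move=> tphi; have [dphi cphi' _] := tphi.
  have cphi : continuous phi.
    by move=> x; apply: differentiable_continuous; apply/derivable1_diffP.
  have i1 (v : H1 mu T) : leb.-integrable `[0, T]
    (EFin \o (fun r => (phi^`())%classic r * dot (v r) w)).
    apply: cont_on_integrable; apply: cont_on_mul; first exact: cont_on_continuous.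
    by apply: cont_on_dot => t; exact: H1_cvg.
  have i2 : leb.-integrable `[0, T] (EFin \o (fun r => phi r * dot (A1 (v1 r)) w)).
    apply: cont_on_integrable; apply: cont_on_mul; first exact: cont_on_continuous.
    exact: cont_on_dot.
  have i3 : leb.-integrable `[0, T] (EFin \o (fun r => phi r * dot (A2 (v2 r)) w)).
    apply: cont_on_integrable; apply: cont_on_mul; first exact: cont_on_continuous.
    exact: cont_on_dot.
  rewrite /f /h; under eq_Rintegral do rewrite /d dotBl mulrBr.
  rewrite RintegralB//.
  under [in RHS]eq_Rintegral do rewrite mulrBr.
  rewrite RintegralB//.
  by rewrite (evolves_weak w T0 A1C ev1 tphi) (evolves_weak w T0 A2C ev2 tphi) opprB opprK
    addrC.
have db r : is_derive r (1 : R) b (b' r).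
  have d1 := is_deriveZ (Q / 2) (dE r).
  have d2 := is_deriveZ (e * B) (is_derive_id r (1 : R)).
  have := is_deriveZ (N w) (is_deriveD d1 d2).
  by rewrite /GRing.scale/= mulr1.
have cb' : continuous b'.
  move=> x; apply: cvgM; first exact: cvg_cst.
  apply: cvgD; last exact: cvg_cst.
  apply: cvgM; first exact: cvg_cst.
  by apply: cvgM; [exact: cvg_cst|exact: cE].
have hb r : r \in `[0, T] -> h r <= b' r.
  move=> rT; rewrite /h -dotBl (le_trans (ler_norm _))// (le_trans (cauchy_schwarz _ _))//.
  rewrite mulrC ler_wpM2l ?L2norm_ge0//.
  have := L2dist_triangle (A1 (v1 r)) (A1 (v2 r)) (A2 (v2 r)).
  have := A1C (v1 r) (v2 r); have := A12 (v2 r).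
  have h1 : e * N (v2 r) <= e * B by rewrite ler_wpM2l// vB.
  have h2 : C * N (v1 r - v2 r) <= C * (Q * E r).
    by rewrite ler_wpM2l ?(ltW C0)//; exact: dQ.
  rewrite (_ : Q / 2 * (2 * C * E r) = C * (Q * E r)); last by field.
  lra.
have := weak_comparison T0 cf ch wd db cb' hb (lexx 0) c0 cT'.
rewrite /f -L2norm_sqr expr2 /b.
have := ler_norm (dot (d 0) w); have := cauchy_schwarz (d 0) w.
rewrite wE.
have E00 : E 0 = 1 by rewrite /E mulr0 expR0.
have Ec : 1 <= E c by rewrite -E00 ler_expR ler_wpM2l// mulr_ge0// ltW.
rewrite E00 mulr0 addr0 -wE => h1 h2 h3.
(* divide by N w, then absorb half of Q * E c *)
have h4 : N w * N w - N (d 0) * N w <= N w * (Q / 2 * E c + e * B * c) - N w * (Q / 2 * 1).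
  lra.
have h5 : N w <= N (d 0) + (Q / 2 * E c + e * B * c) - Q / 2.
  rewrite -(ler_pM2l Nw0); lra.
have h6 : e * B * c <= e * B * T by rewrite ler_wpM2l// mulr_ge0.
have h7 : Q <= Q * E c by rewrite ler_peMr.
move: h5; rewrite wE; lra.
Qed.

End stability.

(** * Convergence of evolutions *)

Lemma ae_lebesgue_neq (R : realType) (p : R) :
  {ae @lebesgue_measure R, forall t, t != p}.
Proof.
exists [set p]; split; [exact: measurable_set1|exact: lebesgue_measure_set1|].
by move=> t /= /negP; rewrite negbK => /eqP.
Qed.

Section evolution_limits.
Context {disp} {X : measurableType disp} {R : realType}.
Variable mu : {measure set X -> \bar R}.
Local Notation N f := (L2norm mu (@Lfunction.sort _ _ _ mu _ (lee1n 2) f)).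
Local Notation leb := (@lebesgue_measure R).

Lemma L2dist_le0 (f g h : L2 mu) : N (f - g) = 0 -> N (f - h) <= N (g - h).
Proof. by move=> fg; have := L2dist_triangle f g h; rewrite fg add0r. Qed.

Lemma H1_norm_bounded (T : R) (v : H1 mu T) : 0 < T ->
  exists2 B : R, 0 <= B & forall t, t \in `[0, T] -> N (v t) <= B.
Proof.
move=> T0; have cN : cont_on T (fun t => N (v t)).
  by apply: cont_on_norm => t; exact: H1_cvg.
have [c cT cmax] := EVT_max (ltW T0) (cont_on_within cN).
by exists (N (v c)); [exact: L2norm_ge0|exact: cmax].
Qed.

Lemma evolves_unique (T C : R) (A : L2 mu -> L2 mu) (a : L2 mu) (v1 v2 : H1 mu T) :
  0 < T -> 0 < C -> lipschitz_op A C -> evolves A v1 -> evolves A v2 ->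
  N (v1 0 - a) = 0 -> N (v2 0 - a) = 0 -> H1_eq v1 v2.
Proof.
move=> T0 C0 AC e1 e2 i1 i2 t tT; apply/L2dist_eq0_ae.
have [B B0 BP] := H1_norm_bounded v2 T0.
have AA (u : L2 mu) : N (A u - A u) <= 0 * N u by rewrite subrr L2norm0 mul0r.
have := evolves_stability T0 C0 (lexx 0) B0 AC AC AA e1 e2 BP tT.
have -> : N (v1 0 - v2 0) = 0.
  apply/eqP; rewrite eq_le L2norm_ge0 andbT.
  by rewrite (le_trans (L2dist_le0 _ i1))// L2normBC i2.
rewrite !mul0r addr0 mul0r => h.
by apply/eqP; rewrite eq_le h L2norm_ge0.
Qed.

(** Stability bounds the distance of the solutions uniformly in time; the
    equations then bound that of the derivatives, so the integrand of the squared
    H1 distance tends to 0 uniformly, off a null set of times. *)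
Lemma evolves_cvg (T C : R) (A_ : nat -> L2 mu -> L2 mu) (A : L2 mu -> L2 mu)
    (e : nat -> R) (u_ : nat -> H1 mu T) (v : H1 mu T) :
  0 < T -> 0 < C -> lipschitz_op A C ->
  (forall n, 0 <= e n) -> e n @[n --> \oo] --> (0 : R) ->
  (\forall n \near \oo, lipschitz_op (A_ n) C /\
     forall u : L2 mu, N (A_ n u - A u) <= e n * N u) ->
  (forall n, evolves (A_ n) (u_ n)) -> evolves A v ->
  N (u_ n 0 - v 0) @[n --> \oo] --> (0 : R) ->
  exists r : nat -> R, [/\ r n @[n --> \oo] --> (0 : R),
    \forall n \near \oo, forall t, t \in `[0, T] ->
      N (u_ n t - v t) <= r n /\ N (A_ n (u_ n t) - A (v t)) <= r n &
    H1_sqdist (u_ n) v @[n --> \oo] --> (0%E : \bar R)].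
Proof.
move=> T0 C0 AC e0 ecvg A_A ev ev_v icvg.
have [B B0 BP] := H1_norm_bounded v T0.
pose r n := (C + 1) * ((N (u_ n 0 - v 0) + e n * B * T) * expR (2 * C * T)) + e n * B.
have rcvg : r n @[n --> \oo] --> (0 : R).
  rewrite [X in _ --> X](_ : 0 = (C + 1) * ((0 + 0 * B * T) * expR (2 * C * T)) + 0 * B);
    last by ring.
  apply: cvgD; last by apply: cvgM => //; exact: cvg_cst.
  apply: cvgM; first exact: cvg_cst.
  apply: cvgM; last exact: cvg_cst.
  apply: cvgD => //.
  apply: cvgM; last exact: cvg_cst.
  by apply: cvgM => //; exact: cvg_cst.
have rP : \forall n \near \oo, forall t, t \in `[0, T] ->
    N (u_ n t - v t) <= r n /\ N (A_ n (u_ n t) - A (v t)) <= r n.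
  apply: filterS A_A => n [AnC AnA] t tT.
  have st := evolves_stability T0 C0 (e0 n) B0 AnC AC AnA (ev n) ev_v BP tT.
  set q := (_ + _) * expR _ in st.
  have q0 : 0 <= q by exact: le_trans (L2norm_ge0 _) st.
  have eB : 0 <= e n * B by rewrite mulr_ge0.
  have rE : r n = C * q + q + e n * B by rewrite /r -/q; ring.
  have Cq : 0 <= C * q by rewrite mulr_ge0 ?(ltW C0).
  split; first by rewrite rE; lra.
  have h1 := L2dist_triangle (A_ n (u_ n t)) (A_ n (v t)) (A (v t)).
  have h2 := AnC (u_ n t) (v t).
  have h3 := AnA (v t).
  have h4 : e n * N (v t) <= e n * B by rewrite ler_wpM2l// BP.
  have h5 : C * N (u_ n t - v t) <= C * q by rewrite ler_wpM2l// ltW.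
  rewrite rE; lra.
exists r; split => //.
apply: cvge_nneg0 => [n|a a0].
  by apply: integral_ge0 => t _; rewrite lee_fin addr_ge0// sqr_ge0.
have r2cvg : r n ^+ 2 @[n --> \oo] --> (0 : R).
  have -> : (fun n => r n ^+ 2) = (fun n => r n * r n) by apply/funext => n; rewrite expr2.
  by rewrite -[X in _ --> X](mulr0 0); exact: cvgM.
have a2T : 0 < a / 2 / T by rewrite !divr_gt0.
move/cvgrPdist_le : r2cvg => /(_ _ a2T) r2.
apply: filterS2 rP r2 => n nP nr.
have {}nr : r n ^+ 2 <= a / 2 / T.
  by move: nr; rewrite sub0r normrN ger0_norm ?sqr_ge0.
apply: (@le_trans _ _ (\int[leb]_(t in `[0%R, T]) (a / T)%:E)%E).
  apply: ae_ge0_le_lower_integral.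
  - by move=> t _; rewrite lee_fin addr_ge0// sqr_ge0.
  - by move=> t _; rewrite lee_fin divr_ge0 ?ltW.
  - have e0T := ae_lebesgueI (ae_lebesgue_neq 0) (ae_lebesgue_neq T).
    apply: ae_lebesgueS (ae_lebesgueI e0T (ae_lebesgueI (ev n) ev_v)).
    move=> t [[tn0 tnT] [evn evt]] tT.
    have [t0 t1] := itvccP tT.
    have tT' : t \in `]0, T[.
      by rewrite in_itv/= !lt_neqAle t0 t1 eq_sym tn0 tnT.
    have [h1 h2] := nP t tT.
    have h3 : N (H1_deriv (u_ n) t - H1_deriv v t) <= r n.
      rewrite (le_trans (L2dist_le0 _ (evn tT')))// L2normBC.
      by rewrite (le_trans (L2dist_le0 _ (evt tT')))// L2normBC.
    have sq (x : R) : 0 <= x -> x <= r n -> x ^+ 2 <= a / 2 / T.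
      move=> x0 xr; rewrite (le_trans _ nr)// lerXn2r// nnegrE//.
      exact: le_trans xr.
    rewrite lee_fin [leRHS](_ : a / T = a / 2 / T + a / 2 / T); last first.
      by rewrite -mulrDl -splitr.
    by apply: lerD; apply: sq => //; exact: L2norm_ge0.
by rewrite integral_cst//= lebesgue_itv0// -EFinM divfK// gt_eqF.
Qed.

End evolution_limits.


Section scaled_operator.
Context {disp} {X : measurableType disp} {R : realType}.
Variable mu : {measure set X -> \bar R}.
Local Notation N f := (L2norm mu (@Lfunction.sort _ _ _ mu _ (lee1n 2) f)).
Variables (B : L2 mu -> L2 mu) (C c : R).
Hypothesis C0 : 0 <= C.
Hypothesis B_bounded : forall u : L2 mu, N (B u) <= C * N u.
Hypothesis B_linear : forall (b : R) (u v : L2 mu), N (B (b *: u + v) - (b *: B u + B v)) = 0.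

Lemma scaled_bounded (u : L2 mu) : N (c *: B u) <= `|c| * C * N u.
Proof. by rewrite L2normZ -mulrA ler_wpM2l. Qed.

Lemma scaled_linear (b : R) (u v : L2 mu) :
  N (c *: B (b *: u + v) - (b *: (c *: B u) + c *: B v)) = 0.
Proof.
by rewrite scalerA mulrC -scalerA -scalerDr -scalerBr L2normZ B_linear mulr0.
Qed.

Lemma scaled_lipschitz : lipschitz_op (fun u => c *: B u) (`|c| * C).
Proof.
move=> u v; rewrite -scalerBr L2normZ -mulrA ler_wpM2l//.
exact: bounded_lip.
Qed.

End scaled_operator.


(** * Integral operators with a symmetric kernel *)

Section kernel_operator.
Context {disp} {X : measurableType disp} {R : realType}.
Variable mu : {sigma_finite_measure set X -> \bar R}.
Local Notation N f := (L2norm mu (@Lfunction.sort _ _ _ mu _ (lee1n 2) f)).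
Implicit Types (k : X -> X -> R) (C : R) (x y : X).

(** By symmetry, the bound on the integrals in y is also one on the integrals
    in x. *)
Definition schur_kernel k C :=
  [/\ measurable_fun setT (fun p : X * X => k p.1 p.2),
      forall x y, k x y = k y x &
      forall x, (\int[mu]_y `|k x y|%:E <= C%:E)%E].

Definition kernel_integral k (u : X -> R) x : R := \int[mu]_y (k x y * u y).

Lemma measurable_kernel_row k C x : schur_kernel k C -> measurable_fun setT (k x).
Proof.
move=> [mk _ _].
exact: (@measurableT_comp _ _ _ _ _ _ (fun p : X * X => k p.1 p.2) _ (pair x)).
Qed.

Lemma measurable_kernel_integral k (u : X -> R) :
  measurable_fun setT (fun p : X * X => k p.1 p.2) ->
  measurable_fun setT u -> measurable_fun setT (kernel_integral k u).
Proof.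
move=> mk mu_.
have mku : measurable_fun setT (fun p : X * X => k p.1 p.2 * u p.2).
  by apply: measurable_funM => //; exact: (measurableT_comp mu_ measurable_snd).
apply: measurableT_comp => //.
pose F (p : X * X) := (k p.1 p.2 * u p.2)%:E.
have mF : measurable_fun setT F by exact/measurable_EFinP.
have -> : (fun x => \int[mu]_y (k x y * u y)%:E)%E =
   (fubini_F mu (F^\+)%E \- fubini_F mu (F^\-)%E)%E.
  by apply/funext => x; rewrite integralE; congr (_ - _)%E; apply: eq_integral => y _;
    rewrite /F ?funeposE ?funenegE.
apply: emeasurable_funB.
- apply: measurable_fun_fubini_tonelli_F => //.
  exact: measurable_funepos.
- apply: measurable_fun_fubini_tonelli_F => //.
  exact: measurable_funeneg.
Qed.

(** Cauchy-Schwarz for sqrt |k x y| and sqrt |k x y| |u y|, as functions of y. *)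
Lemma kernel_weighted_cs k C (u : X -> R) x : schur_kernel k C -> measurable_fun setT u ->
  (\int[mu]_y (`|k x y| * u y ^+ 2)%:E < +oo)%E ->
  mu.-integrable setT (fun y => (k x y * u y)%:E) /\
  ((kernel_integral k u x ^+ 2)%:E <= C%:E * \int[mu]_y (`|k x y| * u y ^+ 2)%:E)%E.
Proof.
move=> sk mu_ fin; have [_ _ kC] := sk; have mkx := measurable_kernel_row x sk.
have mf : measurable_fun setT (fun y => Num.sqrt `|k x y|).
  apply: measurableT_comp; last exact: measurableT_comp.
  apply: continuous_measurable_fun; exact: sqrt_continuous.
have mg : measurable_fun setT (fun y => Num.sqrt `|k x y| * `|u y|).
  by apply: measurable_funM => //; exact: measurableT_comp.
have ff : (\int[mu]_y ((Num.sqrt `|k x y|) ^+ 2)%:E < +oo)%E.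
  under eq_integral do rewrite sqr_sqrtr//.
  by rewrite (le_lt_trans (kC x))// ltry.
have gg : (\int[mu]_y ((Num.sqrt `|k x y| * `|u y|) ^+ 2)%:E < +oo)%E.
  by under eq_integral do rewrite exprMn sqr_sqrtr// real_normK ?num_real//.
have [f fE] := L2_of_sqr_int mf ff.
have [g gE] := L2_of_sqr_int mg gg.
have fg y : f y * g y = `|k x y * u y|.
  by rewrite fE gE mulrA -expr2 sqr_sqrtr// -normrM.
have iku : mu.-integrable setT (fun y => (k x y * u y)%:E).
  apply: le_integrable (integrable_L2_mul f g) => //.
    by apply/measurable_EFinP; exact: measurable_funM.
  by move=> y _; rewrite !abse_EFin lee_fin fg normr_id.
split => //.
have h1 : `|kernel_integral k u x| <= N f * N g.
  rewrite (le_trans (le_normr_Rintegral _ iku))//.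
  rewrite (le_trans _ (cauchy_schwarz f g))// (le_trans _ (ler_norm _))//.
  have -> : dot f g = \int[mu]_y `|k x y * u y|; last by [].
  by apply: eq_Rintegral => y _; exact: fg.
apply: (@le_trans _ _ ((N f * N g) ^+ 2)%:E).
  by rewrite lee_fin -[leLHS]real_normK ?num_real// lerXn2r// nnegrE mulr_ge0 ?L2norm_ge0.
rewrite exprMn EFinM !L2norm_sqr_int fE gE.
under eq_integral do rewrite sqr_sqrtr//.
under [X in (_ * X <= _)%E]eq_integral do rewrite exprMn sqr_sqrtr// real_normK ?num_real//.
apply: lee_wpmul2r; last exact: kC.
by apply: integral_ge0 => y _; rewrite lee_fin mulr_ge0// sqr_ge0.
Qed.

(** Exchange the integrals and integrate first the kernel. *)
Lemma kernel_schur_tonelli k C (u : X -> R) : 0 <= C -> schur_kernel k C ->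
  measurable_fun setT u ->
  measurable_fun setT (fun x => \int[mu]_y (`|k x y| * u y ^+ 2)%:E)%E /\
  (\int[mu]_x \int[mu]_y (`|k x y| * u y ^+ 2)%:E <= C%:E * \int[mu]_y (u y ^+ 2)%:E)%E.
Proof.
move=> C0 sk mu_; have [mk ks kC] := sk.
have mF : measurable_fun setT (fun p : X * X => (`|k p.1 p.2| * u p.2 ^+ 2)%:E).
  apply/measurable_EFinP; apply: measurable_funM; first exact: measurableT_comp.
  by apply: measurable_funX; exact: (measurableT_comp mu_ measurable_snd).
have F0 (p : X * X) : (0 <= (`|k p.1 p.2| * u p.2 ^+ 2)%:E)%E.
  by rewrite lee_fin mulr_ge0// sqr_ge0.
split; first exact: (measurable_fun_fubini_tonelli_F _ mF F0).
rewrite (fubini_tonelli _ mF F0)/=.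
have mu2 : measurable_fun setT (fun y => (u y ^+ 2)%:E).
  by apply/measurable_EFinP; exact: measurable_funX.
rewrite -ge0_integralZl_EFin//; last by move=> y _; rewrite lee_fin sqr_ge0.
apply: ae_ge0_le_lower_integral.
- by move=> y _; apply: integral_ge0 => x _; exact: (F0 (x, y)).
- by move=> y _; rewrite -EFinM lee_fin mulr_ge0// sqr_ge0.
- apply: nearW => y _.
  under eq_integral do rewrite mulrC EFinM.
  rewrite ge0_integralZl_EFin ?sqr_ge0//; last first.
    apply/measurable_EFinP; apply: measurableT_comp => //.
    rewrite (_ : k^~ y = k y); last by apply/funext => x; rewrite ks.
    exact: measurable_kernel_row sk.
  rewrite muleC lee_wpmul2r ?lee_fin ?sqr_ge0//.
  by under eq_integral do rewrite ks; exact: kC.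
Qed.

Lemma kernel_integrable_ae k C (u : L2 mu) : 0 <= C -> schur_kernel k C ->
  {ae mu, forall x, mu.-integrable setT (fun y => (k x y * u y)%:E)}.
Proof.
move=> C0 sk; have [mI bI] := kernel_schur_tonelli C0 sk (measurable_L2 u).
have iI : mu.-integrable setT (fun x => \int[mu]_y (`|k x y| * u y ^+ 2)%:E)%E.
  apply/integrableP; split => //.
  have g0 x : (0 <= \int[mu]_y (`|k x y| * u y ^+ 2)%:E)%E.
    by apply: integral_ge0 => y _; rewrite lee_fin mulr_ge0// sqr_ge0.
  under eq_integral do rewrite (gee0_abs (g0 _)).
  by rewrite (le_lt_trans bI)// -L2norm_sqr_int -EFinM ltry.
have := integrable_ae measurableT iI.
apply: filterS => x /(_ I) fin; apply: (kernel_weighted_cs sk _ _).1 => //.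
by rewrite ltey_eq fin.
Qed.

(** Schur's test. *)
Lemma kernel_sqr_bound k C (u : L2 mu) : 0 < C -> schur_kernel k C ->
  (\int[mu]_x (kernel_integral k u x ^+ 2)%:E <= ((C * N u) ^+ 2)%:E)%E.
Proof.
move=> C0 sk; have [mI bI] := kernel_schur_tonelli (ltW C0) sk (measurable_L2 u).
apply: (@le_trans _ _ (\int[mu]_x (C%:E * \int[mu]_y (`|k x y| * u y ^+ 2)%:E)%E)%E).
  apply: ae_ge0_le_lower_integral.
  - by move=> x _; rewrite lee_fin sqr_ge0.
  - move=> x _; apply: mule_ge0; first by rewrite lee_fin ltW.
    by apply: integral_ge0 => y _; rewrite lee_fin mulr_ge0// sqr_ge0.
  - apply: nearW => x _.
    have [fin|] := ltP (\int[mu]_y (`|k x y| * u y ^+ 2)%:E)%E +oo%E.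
      by apply: (kernel_weighted_cs sk _ fin).2.
    by rewrite leye_eq => /eqP ->; rewrite gt0_muley ?lte_fin// leey.
rewrite ge0_integralZl_EFin ?(ltW C0)//; last first.
  by move=> x _; apply: integral_ge0 => y _; rewrite lee_fin mulr_ge0// sqr_ge0.
have -> : ((C * N u) ^+ 2)%:E = (C%:E * (C%:E * \int[mu]_y (u y ^+ 2)%:E))%E.
  by rewrite -L2norm_sqr_int -!EFinM; congr EFin; ring.
by apply: lee_wpmul2l => //; rewrite lee_fin ltW.
Qed.

(** Linearity holds only modulo null functions: it may fail at the points x where
    one of the integrals does not converge, and these depend on u and v. *)
Lemma kernel_operator_exists k C : 0 < C -> schur_kernel k C ->
  exists A : L2 mu -> L2 mu,
    [/\ forall u, A u = kernel_integral k u :> (X -> R),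
        forall u : L2 mu, N (A u) <= C * N u &
        forall (c : R) (u v : L2 mu), N (A (c *: u + v) - (c *: A u + A v)) = 0].
Proof.
move=> C0 sk.
have /choice[A AE] : forall u : L2 mu, exists v : L2 mu, v = kernel_integral k u :> (X -> R).
  move=> u; apply: L2_of_sqr_int.
    have [mk _ _] := sk; exact: (measurable_kernel_integral mk (measurable_L2 u)).
  by rewrite (le_lt_trans (kernel_sqr_bound u C0 sk))// ltry.
exists A; split => //.
- move=> u; rewrite -(@ler_pXn2r _ 2)// ?nnegrE ?mulr_ge0 ?L2norm_ge0 ?(ltW C0)//.
  rewrite -lee_fin L2norm_sqr_int AE; exact: kernel_sqr_bound.
- move=> c u v; apply/L2dist_eq0_ae.
  have iu := kernel_integrable_ae u (ltW C0) sk.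
  have iv := kernel_integrable_ae v (ltW C0) sk.
  near=> x => _.
  have iux : mu.-integrable setT (fun y => (k x y * u y)%:E) by near: x.
  have ivx : mu.-integrable setT (fun y => (k x y * v y)%:E) by near: x.
  transitivity (c * A u x + A v x); last by [].
  rewrite !AE /kernel_integral -RintegralZl// -RintegralD//; last first.
    by have := integrableZl measurableT c iux.
  by apply: eq_Rintegral => y _; rewrite -[(c *: u + v) y]/(c * u y + v y); ring.
Unshelve. all: end_near. Qed.

(** Almost everywhere, the difference of the operators is the integral operator of
    the difference of the kernels, to which Schur's test applies. *)
Lemma kernel_operator_dist k1 k2 C1 C2 e (A1 A2 : L2 mu -> L2 mu) : 0 < C1 -> 0 < C2 ->
  0 < e ->
  schur_kernel k1 C1 -> schur_kernel k2 C2 ->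
  (forall x, (\int[mu]_y `|k1 x y - k2 x y|%:E <= e%:E)%E) ->
  (forall u, A1 u = kernel_integral k1 u :> (X -> R)) ->
  (forall u, A2 u = kernel_integral k2 u :> (X -> R)) ->
  forall u : L2 mu, N (A1 u - A2 u) <= e * N u.
Proof.
move=> C10 C20 e0 s1 s2 k12 A1E A2E u.
have s12 : schur_kernel (fun x y => k1 x y - k2 x y) e.
  have [m1 ks1 _] := s1; have [m2 ks2 _] := s2; split => //.
    exact: measurable_funB.
  by move=> x y; rewrite ks1 ks2.
have [A [AE AN _]] := kernel_operator_exists e0 s12.
rewrite (_ : N _ = N (A u))//.
have i1 := kernel_integrable_ae u (ltW C10) s1.
have i2 := kernel_integrable_ae u (ltW C20) s2.
have h : N ((A1 u - A2 u) - A u) = 0.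
  apply/L2dist_eq0_ae; near=> x => _.
  have i1x : mu.-integrable setT (fun y => (k1 x y * u y)%:E) by near: x.
  have i2x : mu.-integrable setT (fun y => (k2 x y * u y)%:E) by near: x.
  transitivity (A1 u x - A2 u x); first by [].
  rewrite A1E A2E AE /kernel_integral -RintegralB//.
  by apply: eq_Rintegral => y _; rewrite mulrBl.
apply/eqP; rewrite -subr_eq0 -normr_le0 -h; exact: L2norm_dist.
Unshelve. all: end_near. Qed.

End kernel_operator.

(** * Lebesgue measure on the domain *)

Section restricted_measure.
Variables (R : realType) (d : nat) (Omega : set 'rV[R]_d) (oOmega : open Omega).
Local Notation mu := (lebesgue_on oOmega).
Let mOmega : measurable Omega := open_measurable_rV oOmega.

Let lebesgue_on_sigma_finite : sigma_finite setT mu.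
Proof.
have [F FT Foo] := sigma_finiteT (lebesgue_rV R d).
exists F => // i; have [mF Fi] := Foo i; split => //.
apply: le_lt_trans Fi; apply: le_measure; rewrite ?inE//.
exact: (measurableI _ _ mF mOmega).
Qed.

HB.instance Definition _ := Measure_isSigmaFinite.Build _ _ _ (lebesgue_on oOmega)
  lebesgue_on_sigma_finite.

Lemma lebesgue_on_setC : mu (~` Omega) = 0%E.
Proof. by rewrite /lebesgue_on /mrestr setICl measure0. Qed.

Lemma lebesgue_on_le (A : set 'rV[R]_d) : measurable A -> (mu A <= lebesgue_rV R d A)%E.
Proof.
by move=> mA; apply: le_measure; rewrite ?inE//; exact: (measurableI _ _ mA mOmega).
Qed.

Lemma ae_lebesgue_on (P : 'rV[R]_d -> Prop) : (forall x, Omega x -> P x) ->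
  {ae mu, forall x, P x}.
Proof.
move=> OP; exists (~` Omega); split; first exact: (measurableC mOmega).
  exact: lebesgue_on_setC.
by move=> x /= nP Ox; apply: nP; exact: OP.
Qed.

Lemma ge0_integral_lebesgue_on (f : 'rV[R]_d -> \bar R) :
  measurable_fun setT f -> (forall x, 0 <= f x)%E ->
  (\int[lebesgue_rV R d]_(x in Omega) f x = \int[mu]_x f x)%E.
Proof.
move=> mf f0.
rewrite [RHS](@ge0_negligible_integral _ _ _ mu setT (~` Omega))//; last 2 first.
- exact: (measurableC mOmega).
- exact: lebesgue_on_setC.
rewrite setTD setCK; apply: eq_measure_integral => A mA AO.
by rewrite -[RHS]/(lebesgue_rV R d (A `&` Omega)) (setIidl AO).
Qed.

Lemma Rintegral_lebesgue_on (f : 'rV[R]_d -> R) : measurable_fun setT f ->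
  \int[lebesgue_rV R d]_(x in Omega) f x = \int[mu]_x f x.
Proof.
move=> mf; congr fine; rewrite integralE [RHS]integralE.
have mf' : measurable_fun setT (EFin \o f) by exact/measurable_EFinP.
rewrite !ge0_integral_lebesgue_on//.
- exact: measurable_funeneg.
- exact: measurable_funepos.
Qed.

Hypothesis bOmega : bounded_set Omega.

Lemma bounded_coord : exists2 M : R, 0 < M & forall x i, Omega x -> `|x ord0 i| <= M.
Proof.
have [M [Mr MP]] := bOmega; exists (`|M| + 1); first by rewrite ltr_wpDl.
move=> x i Ox; have := MP (`|M| + 1) _ x Ox.
rewrite (le_lt_trans (ler_norm _)) ?ltrDl// => /(_ isT) /=; apply: le_trans.
rewrite [leRHS]mx_normrE.
exact: (le_bigmax _ (fun ij : 'I_1 * 'I_d => `|x ij.1 ij.2|) (ord0, i)).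
Qed.

Lemma integral_cst_lebesgue_on : exists2 V : R, 0 <= V &
  forall c : R, (\int[mu]_y c%:E)%E = (c * V)%:E.
Proof.
have [M M0 MP] := bounded_coord.
pose a : 'rV[R]_d := \row_i (- M). pose b : 'rV[R]_d := \row_i M.
have ab i : a ord0 i <= b ord0 i by rewrite !mxE; lra.
have sub : Omega `<=` rV_box a b.
  by move=> x Ox i; rewrite in_itv/= !mxE -ler_norml; exact: MP.
have fin : (mu setT < +oo)%E.
  rewrite /lebesgue_on /mrestr setTI.
  apply: (@le_lt_trans _ _ (lebesgue_rV R d (rV_box a b))).
    by apply: le_measure; rewrite ?inE//; apply: measurable_rV_box.
  by rewrite lebesgue_rV_box// ltry.
exists (fine (mu setT)); first by rewrite fine_ge0.
by move=> c; rewrite integral_cst// EFinM fineK// ge0_fin_numE.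
Qed.

End restricted_measure.


(** * The Riesz kernel *)

Section euclidean_norm.
Variables (R : realType) (d : nat).
Implicit Types x y : 'rV[R]_d.

Lemma enorm_ge0 x : 0 <= enorm x.
Proof. exact: sqrtr_ge0. Qed.

Lemma enorm_sym x y : enorm (x - y) = enorm (y - x).
Proof.
by congr Num.sqrt; apply: eq_bigr => i _; rewrite !mxE -sqrrN opprB.
Qed.

Lemma enorm_coord x i : `|x ord0 i| <= enorm x.
Proof.
rewrite -sqrtr_sqr ler_sqrt; last by apply: sumr_ge0 => j _; exact: sqr_ge0.
by rewrite (bigD1 i)//= lerDl; apply: sumr_ge0 => j _; exact: sqr_ge0.
Qed.

Lemma enorm_le x (M : R) : 0 <= M -> (forall i, `|x ord0 i| <= M) ->
  enorm x <= Num.sqrt (d%:R * M ^+ 2).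
Proof.
move=> M0 xM; rewrite ler_wsqrtr//.
rewrite (@le_trans _ _ (\sum_(i < d) M ^+ 2))//.
  by apply: ler_sum => i _; rewrite -[leLHS]real_normK ?num_real// lerXn2r ?nnegrE.
by rewrite sumr_const card_ord mulr_natl.
Qed.

Lemma measurable_enorm_sub :
  measurable_fun setT (fun p : 'rV[R]_d * 'rV[R]_d => enorm (p.1 - p.2)).
Proof.
apply: (@measurableT_comp _ _ _ _ _ _ (@Num.sqrt R)).
  by apply: continuous_measurable_fun; exact: sqrt_continuous.
apply: measurable_sum => i; apply: measurable_funX.
have mc : measurable_fun setT (fun x : 'rV[R]_d => x ord0 i).
  by apply: continuous_measurable_rV; exact: coord_continuous.
rewrite (_ : (fun p : 'rV[R]_d * 'rV[R]_d => (p.1 - p.2) ord0 i) =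
  (fun p => p.1 ord0 i - p.2 ord0 i)); last by apply/funext => p; rewrite !mxE.
apply: measurable_funB.
- exact: (measurableT_comp mc measurable_fst).
- exact: (measurableT_comp mc measurable_snd).
Qed.

End euclidean_norm.

Section dyadic.
Variable R : realType.
Implicit Types r s : R.

Lemma dyadic_shell r : 0 < r -> r <= 1 -> exists k : nat, 2^-1 ^+ k.+1 < r /\ r <= 2^-1 ^+ k.
Proof.
move=> r0 r1.
have ex : exists k, 2^-1 ^+ k.+1 < r.
  have h1 : `|2^-1 : R| < 1 by rewrite ger0_norm ?invr_ge0// invf_lt1// ltr1n.
  have /cvgrPdist_lt /(_ r r0) [n _ /(_ n.+1 (leqnSn n))] := cvg_expr h1.
  by rewrite /= sub0r normrN ger0_norm ?exprn_ge0 ?invr_ge0// => h; exists n.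
pose k := ex_minn ex; exists k; rewrite /k; case: ex_minnP => m mr mmin; split => //.
case: m mr mmin => [|m] mr mmin; first by rewrite expr0.
by rewrite leNgt; apply/negP => /mmin; rewrite ltnn.
Qed.

Lemma powR_half_exp s n : (2^-1 ^+ n) `^ s = ((2 `^ s) ^+ n)^-1 :> R.
Proof.
have h : (2^-1) `^ s = (2 `^ s)^-1 :> R.
  apply: (@mulfI _ (2 `^ s)); first by rewrite gt_eqF// powR_gt0.
  by rewrite -powRM ?invr_ge0// mulfV// powR1 mulfV// gt_eqF// powR_gt0.
elim: n => [|n IH]; first by rewrite !expr0 powR1 invr1.
by rewrite !exprS powRM ?invr_ge0 ?exprn_ge0 ?invr_ge0// h IH invfM.
Qed.

(** If 2^(-k-1) < r <= 2^-k then r^(-s) <= 2^(s (k + 1)). *)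
Lemma powRN_dyadic r s : 0 < s -> 0 <= r ->
  r `^ (- s) <= 1 \/ exists k, r <= 2^-1 ^+ k /\ r `^ (- s) <= (2 `^ s) ^+ k.+1.
Proof.
move=> s0; rewrite le_eqVlt => /predU1P[<-|r0].
  by left; rewrite powRN powR0 ?invr0// gt_eqF.
have [r1|r1] := leP 1 r.
  left; rewrite powRN invf_le1 ?powR_gt0//.
  rewrite [leLHS](_ : 1 = 1 `^ s); last by rewrite powR1.
  by apply: ge0_ler_powR; rewrite ?nnegrE ?(ltW s0) ?(ltW r0).
right; have [k [k1 k2]] := dyadic_shell r0 (ltW r1); exists k; split => //.
rewrite powRN -[leRHS]invrK -powR_half_exp lef_pV2 ?posrE ?powR_gt0 ?exprn_gt0 ?invr_gt0//.
by apply: ge0_ler_powR; rewrite ?nnegrE ?(ltW s0) ?(ltW r0) ?exprn_ge0 ?invr_ge0 ?(ltW k1).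
Qed.

Lemma ln_le r : 0 < r -> ln r <= r.
Proof.
by move=> r0; have := expR_ge1Dx (ln r); rewrite lnK ?posrE//; lra.
Qed.

(** t |-> r^(-t) is convex with value 1 at 0. Its chord over [0, s0] gives the upper
    bound and its tangent at 0 the lower one. *)
Lemma powRN_sub1 r s s0 : 0 < r -> 0 < s -> s <= s0 ->
  `|r `^ (- s) - 1| <= s / s0 * (r `^ (- s0) + 1) + s * r.
Proof.
move=> r0 sp ss0; have s00 : 0 < s0 by exact: lt_le_trans ss0.
have rE t : r `^ (- t) = expR (t * (- ln r)).
  by rewrite /powR gt_eqF// mulNr mulrN.
rewrite !rE; set L := - ln r; set y := expR (s * L).
have y0 : 0 < y by exact: expR_gt0.
have e1 : expR (s0 * L) = y * expR ((s0 - s) * L) by rewrite -expRD; congr expR; ring.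
have e2 : 1 = y * expR (- (s * L)) by rewrite -expRD subrr expR0.
(* the tangent line of exp at s L lies below exp at s0 L and at 0 *)
have h1 : y * (1 + (s0 - s) * L) <= expR (s0 * L).
  by rewrite e1 ler_wpM2l ?(ltW y0)// expR_ge1Dx.
have h2 : y * (1 - s * L) <= 1.
  by rewrite [leRHS]e2 ler_wpM2l ?(ltW y0)// expR_ge1Dx.
have h3 : 1 + s * L <= y by exact: expR_ge1Dx.
have h4 : - r <= L by rewrite lerN2 ln_le.
set th := s / s0.
have th0 : 0 < th by rewrite divr_gt0.
have th1 : th <= 1 by rewrite ler_pdivrMr// mul1r.
have ths : th * s0 = s by rewrite divfK// gt_eqF.
have up : y <= th * expR (s0 * L) + (1 - th).
  have h1' := ler_wpM2l (ltW th0) h1.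
  have h2' : (1 - th) * (y * (1 - s * L)) <= (1 - th) * 1 by rewrite ler_wpM2l// subr_ge0.
  have -> : y = th * (y * (1 + (s0 - s) * L)) + (1 - th) * (y * (1 - s * L)).
    have -> : th * (y * (1 + (s0 - s) * L)) = y * (th + (th * s0 - th * s) * L) by ring.
    by rewrite ths; ring.
  by rewrite -[X in _ <= _ + X]mulr1 lerD.
have sL : - (s * r) <= s * L by rewrite -mulrN ler_wpM2l ?(ltW sp).
have p1 : 0 <= th * expR (s0 * L) by rewrite mulr_ge0 ?expR_ge0 ?(ltW th0).
have p2 : 0 <= s * r by rewrite mulr_ge0 ?ltW.
rewrite mulrDr mulr1 ler_norml; apply/andP; split; lra.
Qed.

End dyadic.

Section riesz_kernel.
Variables (R : realType) (d : nat) (Omega : set 'rV[R]_d) (oOmega : open Omega).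
Hypotheses (d_gt0 : (0 < d)%N) (bOmega : bounded_set Omega).
Local Notation mu := (lebesgue_on oOmega).
Implicit Types (x y : 'rV[R]_d) (s : R).
Let mOmega : measurable Omega := open_measurable_rV oOmega.

Lemma measurable_powRN_enorm s :
  measurable_fun setT (fun p : 'rV[R]_d * 'rV[R]_d => enorm (p.1 - p.2) `^ (- s)).
Proof.
exact: (measurableT_comp (measurable_powR (- s)) (@measurable_enorm_sub R d)).
Qed.

Lemma measurable_powRN_enorm_row s x :
  measurable_fun setT (fun y => enorm (x - y) `^ (- s)).
Proof.
exact: (@measurableT_comp _ _ _ _ _ _
  (fun p : 'rV[R]_d * 'rV[R]_d => enorm (p.1 - p.2) `^ (- s)) _ (pair x)
  (measurable_powRN_enorm s)).
Qed.

Definition cube x (r : R) : set 'rV[R]_d := rV_box (x - const_mx r) (x + const_mx r).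

Lemma measurable_cube x r : measurable (cube x r).
Proof. exact: measurable_rV_box. Qed.

(** The maximum norm is at most the Euclidean norm. Cubes replace balls because
    their volume is explicit. *)
Lemma enorm_cube x y r : enorm (x - y) <= r -> cube x r y.
Proof.
move=> xyr i; rewrite in_itv/= !mxE.
have := le_trans (enorm_coord (x - y) i) xyr.
by rewrite !mxE ler_norml => /andP[? ?]; apply/andP; split; lra.
Qed.

Lemma lebesgue_on_cube x r : 0 <= r -> (mu (cube x r) <= ((2 * r) ^+ d)%:E)%E.
Proof.
move=> r0; apply: (le_trans (lebesgue_on_le oOmega (measurable_cube x r))).
rewrite lebesgue_rV_box => [|i]; last by rewrite !mxE; lra.
rewrite lee_fin (eq_bigr (fun=> 2 * r)) => [|i _]; last by rewrite !mxE; ring.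
by rewrite prodr_const card_ord.
Qed.

(** By the dyadic bound, |x - y|^(-s) is at most 1 plus the sum over k of
    2^(s (k + 1)) times the indicator of the cube of center x and radius 2^-k. The
    volume of that cube is 2^(d (1 - k)), and the resulting geometric series has
    ratio 2^(s - d) < 1. *)
Lemma integral_powRN_enorm s : 0 < s -> s < d%:R ->
  exists2 C : R, 0 < C & forall x, (\int[mu]_y (enorm (x - y) `^ (- s))%:E <= C%:E)%E.
Proof.
move=> s0 sd; have [V V0 VE] := integral_cst_lebesgue_on oOmega bOmega.
(* the k-th cube, weighted by its coefficient, has volume A * q ^+ k *)
pose A : R := 2 `^ s * 2 ^+ d.
pose q : R := 2 `^ s / 2 ^+ d.
have A0 : 0 <= A by rewrite mulr_ge0 ?powR_ge0 ?exprn_ge0.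
have q0 : 0 <= q by rewrite divr_ge0 ?powR_ge0 ?exprn_ge0.
have q1 : `|q| < 1.
  rewrite ger0_norm// ltr_pdivrMr ?exprn_gt0// mul1r -powR_mulrn//.
  by rewrite /powR pnatr_eq0/= ltr_expR ltr_pM2r ?ln_gt0 ?ltr1n.
have cg : cvgn (series (geometric A q)) by exact: is_cvg_geometric_series.
set L := limn (series (geometric A q)) in cg.
have LE : (\sum_(0 <= k <oo) (A * q ^+ k)%:E)%E = L%:E.
  rewrite (_ : (fun n : nat => _) = EFin \o series (geometric A q)).
    by rewrite EFin_lim.
  by apply/funext => n; rewrite /series/= sumEFin.
have L0 : 0 <= L.
  by rewrite -lee_fin -LE; apply: nneseries_ge0 => k _ _; rewrite lee_fin mulr_ge0 ?exprn_ge0.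
exists (V + L + 1); first by lra.
move=> x.
pose c k : R := (2 `^ s) ^+ k.+1.
have c0 k : 0 <= c k by rewrite exprn_ge0 ?powR_ge0.
pose B k := cube x (2^-1 ^+ k).
pose F k y : \bar R := ((c k)%:E * (\1_(B k) y)%:E)%E.
have F0 k y : (0 <= F k y)%E by rewrite mule_ge0// lee_fin.
have mF k : measurable_fun setT (F k).
  apply: measurable_funeM; apply/measurable_EFinP.
  apply: measurable_indic; exact: measurable_cube.
have iF k : (\int[mu]_y F k y <= (A * q ^+ k)%:E)%E.
  rewrite ge0_integralZl_EFin//; last first.
    by apply/measurable_EFinP; apply: measurable_indic; exact: measurable_cube.
  rewrite integral_indic//; last exact: measurable_cube.
  rewrite setIT (@le_trans _ _ ((c k)%:E * ((2 * 2^-1 ^+ k) ^+ d)%:E)%E)//.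
    by rewrite lee_wpmul2l ?lee_fin// lebesgue_on_cube// exprn_ge0 ?invr_ge0.
  rewrite -EFinM lee_fin /c /A /q expr_div_n exprS exprMn exprVn exprVn.
  rewrite -!exprM mulnC le_eqVlt; apply/orP; left; apply/eqP.
  by rewrite exprM; ring.
pose G y : \bar R := (1 + \sum_(0 <= k <oo) F k y)%E.
apply: (@le_trans _ _ (\int[mu]_y G y)%E).
  apply: ae_ge0_le_lower_integral.
  - by move=> y _; rewrite lee_fin powR_ge0.
  - by move=> y _; rewrite adde_ge0// nneseries_ge0.
  - apply: nearW => y _.
    have [h|[k [k1 k2]]] := powRN_dyadic s0 (enorm_ge0 (x - y)).
      apply: (@le_trans _ _ 1%E); first by rewrite lee_fin.
      by rewrite leeDl// nneseries_ge0.
    rewrite (@le_trans _ _ (F k y))//.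
      rewrite /F indicE mem_set ?mule1 ?lee_fin//; exact: enorm_cube.
    rewrite (@le_trans _ _ (0 + \sum_(0 <= k <oo) F k y)%E)//; last first.
      by rewrite leeD2r.
    rewrite add0e (le_trans _ (nneseries_lim_ge k.+1 _))//.
    by rewrite big_nat_recr//= leeDr// sume_ge0.
have mS : measurable_fun setT (fun y => \sum_(0 <= k <oo) F k y)%E.
  by apply: ge0_emeasurable_sum => // k y _ _.
rewrite ge0_integralD//; last by move=> y _; exact: nneseries_ge0.
rewrite VE mul1r integral_nneseries//.
apply: (@le_trans _ _ (V%:E + L%:E)%E); last by rewrite -EFinD lee_fin lerDl.
rewrite leeD2l// -LE; apply: lee_nneseries => // k _.
by move=> _; apply: integral_ge0 => y _.
Qed.

(** The kernels are cut off outside the domain in both variables: |x - y| is then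
    bounded where they do not vanish, so that estimates hold uniformly over all x
    of the whole space. *)
Definition riesz_kernel s x y : R :=
  \1_Omega x * \1_Omega y * enorm (x - y) `^ (- s).

Definition unit_kernel x y : R := \1_Omega x * \1_Omega y.

Lemma indic01 x : 0 <= (\1_Omega x : R) <= 1.
Proof. by rewrite indicE; case: (x \in Omega); rewrite ?lexx ?ler01. Qed.

Lemma measurable_unit_kernel :
  measurable_fun setT (fun p : 'rV[R]_d * 'rV[R]_d => unit_kernel p.1 p.2).
Proof.
have mi : measurable_fun setT (\1_Omega : 'rV[R]_d -> R) by exact: measurable_indic.
apply: measurable_funM.
- exact: (measurableT_comp mi measurable_fst).
- exact: (measurableT_comp mi measurable_snd).
Qed.

Lemma unit_kernel_schur : exists2 C : R, 0 < C & schur_kernel mu unit_kernel C.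
Proof.
have [V V0 VE] := integral_cst_lebesgue_on oOmega bOmega.
exists (V + 1); first by rewrite ltr_wpDl.
split; first exact: measurable_unit_kernel.
  by move=> x y; rewrite /unit_kernel mulrC.
move=> x; apply: (@le_trans _ _ (\int[mu]_y 1%:E)%E).
  apply: ae_ge0_le_lower_integral => //; apply: nearW => y _.
  have /andP[a0 a1] := indic01 x; have /andP[b0 b1] := indic01 y.
  by rewrite lee_fin ger0_norm ?mulr_ge0// mulr_ile1.
by rewrite VE mul1r lee_fin lerDl.
Qed.

Lemma riesz_kernel_schur s : 0 < s -> s < d%:R ->
  exists2 C : R, 0 < C & schur_kernel mu (riesz_kernel s) C.
Proof.
move=> s0 sd; have [C C0 CP] := integral_powRN_enorm s0 sd.
exists C; first exact: C0.
split.
- apply: measurable_funM; first exact: measurable_unit_kernel.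
  exact: measurable_powRN_enorm.
- by move=> x y; rewrite /riesz_kernel enorm_sym; congr (_ * _); rewrite mulrC.
- move=> x; apply: le_trans (CP x).
  apply: ae_ge0_le_lower_integral => //.
    by move=> y _; rewrite lee_fin powR_ge0.
  apply: nearW => y _.
  have /andP[a0 a1] := indic01 x; have /andP[b0 b1] := indic01 y.
  rewrite lee_fin ger0_norm ?mulr_ge0 ?powR_ge0//.
  by rewrite ler_piMl ?powR_ge0// mulr_ile1.
Qed.

(** Integrate the bound of [powRN_sub1]; its right-hand side is s times a function
    of y whose integral is bounded uniformly in x. On the diagonal, where the Riesz
    kernel is 0 by convention and the bound fails, the difference is 1, but the
    diagonal is negligible. *)
Lemma riesz_kernel_cvg : exists s0 K : R, [/\ 0 < s0, 0 < K &
  forall s, 0 < s -> s <= s0 -> forall x,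
    (\int[mu]_y `|riesz_kernel s x y - unit_kernel x y|%:E <= (s * K)%:E)%E].
Proof.
have [V V0 VE] := integral_cst_lebesgue_on oOmega bOmega.
have [M M0 MP] := bounded_coord bOmega.
have d0 : 0 < d%:R :> R by rewrite ltr0n.
pose s0 : R := d%:R / 2.
have s00 : 0 < s0 by rewrite divr_gt0.
have s0d : s0 < d%:R by rewrite /s0; lra.
have [C C0 CP] := integral_powRN_enorm s00 s0d.
pose D : R := Num.sqrt (d%:R * (2 * M) ^+ 2).
have D0 : 0 <= D by exact: sqrtr_ge0.
exists s0, (s0^-1 * (C + V) + D * V + 1); split => //.
  by rewrite ltr_wpDl// addr_ge0 ?mulr_ge0 ?invr_ge0 ?addr_ge0 ?(ltW s00) ?(ltW C0).
move=> s sp ss0 x.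
(* the diagonal, as a degenerate cube *)
pose Z := cube x 0.
have mZ : measurable Z by exact: measurable_cube.
have Z0 : mu Z = 0%E.
  apply/eqP; rewrite eq_le measure_ge0 andbT.
  by rewrite (le_trans (lebesgue_on_cube x (lexx 0)))// mulr0 expr0n gtn_eqF.
pose F1 y : \bar R := ((s / s0)%:E * (enorm (x - y) `^ (- s0))%:E)%E.
pose F2 y : \bar R := (s / s0 + s * D)%:E.
pose F3 y : \bar R := (\1_Z y)%:E.
have m1 : measurable_fun setT F1.
  by apply: measurable_funeM; apply/measurable_EFinP; exact: measurable_powRN_enorm_row.
have m3 : measurable_fun setT F3 by apply/measurable_EFinP; exact: measurable_indic.
have m2 : measurable_fun setT F2 by exact: measurable_cst.
have c0 : 0 <= s / s0 by rewrite divr_ge0 ?ltW.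
have c2 : 0 <= s / s0 + s * D by apply: addr_ge0 => //; apply: mulr_ge0 => //; exact: ltW.
have p1 y : (0 <= F1 y)%E by rewrite mule_ge0// lee_fin powR_ge0.
have p2 y : (0 <= F2 y)%E by rewrite lee_fin.
have p3 y : (0 <= F3 y)%E by rewrite lee_fin.
apply: (@le_trans _ _ (\int[mu]_y (F1 y + F2 y + F3 y))%E).
  apply: ae_ge0_le_lower_integral => //.
    by move=> y _; rewrite !adde_ge0.
  apply: nearW => y _.
  have -> : riesz_kernel s x y - unit_kernel x y =
      unit_kernel x y * (enorm (x - y) `^ (- s) - 1).
    by rewrite /riesz_kernel /unit_kernel mulrBr mulr1.
  rewrite /F1 /F2 /F3 -EFinM -!EFinD lee_fin.
  have P0 : 0 <= s / s0 * enorm (x - y) `^ (- s0) by rewrite mulr_ge0// powR_ge0.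
  have I0 : 0 <= (\1_Z y : R) by [].
  rewrite /unit_kernel !indicE.
  have I0' : 0 <= ((y \in Z)%:R : R) by [].
  have RHS0 : 0 <= s / s0 * enorm (x - y) `^ (- s0) + (s / s0 + s * D) + (y \in Z)%:R.
    by apply: addr_ge0 => //; apply: addr_ge0.
  have [Ox|Ox] := boolP (x \in Omega); last by rewrite !mul0r normr0.
  have [Oy|Oy] := boolP (y \in Omega); last by rewrite mulr0 mul0r normr0.
  rewrite !mul1r; have := enorm_ge0 (x - y).
  rewrite le_eqVlt => /predU1P[e0|e0].
    rewrite -e0 !powRN !powR0 ?gt_eqF// invr0 sub0r normrN normr1 mulr0 add0r.
    rewrite mem_set ?lerDr//; apply: enorm_cube; by rewrite -e0.
  rewrite (le_trans (powRN_sub1 e0 sp ss0))//.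
  have eD : enorm (x - y) <= D.
    apply: enorm_le => [|i]; first by rewrite mulr_ge0 ?ltW.
    rewrite !mxE (le_trans (ler_normB _ _))//.
    have := MP x i (set_mem Ox); have := MP y i (set_mem Oy); lra.
  have sD : s * enorm (x - y) <= s * D by rewrite ler_wpM2l// ltW.
  rewrite mulrDr mulr1; lra.
rewrite ge0_integralD//; last 2 first.
- by move=> y _; rewrite adde_ge0.
- exact: emeasurable_funD.
have F30 : (\int[mu]_y F3 y = 0)%E by rewrite integral_indic// setIT; exact: Z0.
rewrite F30 adde0 ge0_integralD//.
rewrite ge0_integralZl_EFin//; last 2 first.
- by move=> y _; rewrite lee_fin powR_ge0.
- by apply/measurable_EFinP; exact: measurable_powRN_enorm_row.
rewrite VE.
apply: (@le_trans _ _ ((s / s0)%:E * C%:E + ((s / s0 + s * D) * V)%:E)%E).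
  by rewrite leeD2r// lee_wpmul2l// lee_fin.
rewrite -EFinM -EFinD lee_fin.
have -> : s * (s0^-1 * (C + V) + D * V + 1) =
   s / s0 * C + (s / s0 + s * D) * V + s by ring.
by rewrite lerDl ltW.
Qed.

End riesz_kernel.

(** * The Riesz evolutions and their limit *)

Section riesz_evolution.
Variables (R : realType) (d : nat) (Omega : set 'rV[R]_d) (oOmega : open Omega).
Hypotheses (d_gt0 : (0 < d)%N) (bOmega : bounded_set Omega).
Local Notation mu := (lebesgue_on oOmega).
Local Notation N f := (L2norm mu (@Lfunction.sort _ _ _ mu _ (lee1n 2) f)).
Let mOmega : measurable Omega := open_measurable_rV oOmega.

Lemma indic1 x : Omega x -> \1_Omega x = 1 :> R.
Proof. by move=> Ox; rewrite indicE mem_set. Qed.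

Lemma riesz_kernel_integralE (s : R) (v : 'rV[R]_d -> R) x : measurable_fun setT v ->
  Omega x -> kernel_integral mu (riesz_kernel Omega s) v x =
  \int[lebesgue_rV R d]_(y in Omega) (v y / enorm (x - y) `^ s).
Proof.
move=> mv Ox; rewrite /kernel_integral -Rintegral_lebesgue_on; last first.
  apply: measurable_funM => //; apply: measurable_funM.
    by apply: measurable_funM => //; exact: measurable_indic.
  exact: measurable_powRN_enorm_row.
apply: eq_Rintegral => y /set_mem Oy.
by rewrite /riesz_kernel !indic1// !mul1r powRN mulrC.
Qed.

Lemma unit_kernel_integralE (v : 'rV[R]_d -> R) x : measurable_fun setT v ->
  Omega x -> kernel_integral mu (unit_kernel Omega) v x =
  \int[lebesgue_rV R d]_(y in Omega) v y.
Proof.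
move=> mv Ox; rewrite /kernel_integral -Rintegral_lebesgue_on; last first.
  by apply: measurable_funM => //; apply: measurable_funM => //; exact: measurable_indic.
apply: eq_Rintegral => y /set_mem Oy.
by rewrite /unit_kernel !indic1// !mul1r.
Qed.

Lemma solves_riesz_evolves (sigma alpha T : R) (B : L2 mu -> L2 mu) (a : L2 mu) (u : H1 mu T) :
  (forall v, B v = kernel_integral mu (riesz_kernel Omega (d%:R - alpha)) v
    :> ('rV[R]_d -> R)) ->
  solves_riesz sigma alpha a u <->
  evolves (fun v => (2 * sigma) *: B v) u /\ N (u 0 - a) = 0.
Proof.
move=> BE; rewrite /solves_riesz L2dist_eq0_ae.
have E (f v : L2 mu) : f = (fun x => sigma * riesz_potential alpha Omega v x) %[ae mu] <->
    N (f - (2 * sigma) *: B v) = 0.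
  rewrite L2dist_eq0_ae.
  have key : {ae mu, forall x, sigma * riesz_potential alpha Omega v x =
    ((2 * sigma) *: B v) x}.
    apply: ae_lebesgue_on => x Ox.
    rewrite -[RHS]/(2 * sigma * B v x) BE riesz_kernel_integralE//.
    by rewrite /riesz_potential; ring.
  by split; apply: filterS2 key => x h1 /(_ I) h2 _; rewrite h2 h1.
by split=> -[h1 h2]; split => //; apply: ae_lebesgueS h1 => t h tT; apply/E; exact: h.
Qed.

Lemma solves_limit_evolves (sigma T : R) (B : L2 mu -> L2 mu) (a : L2 mu) (u : H1 mu T) :
  (forall v, B v = kernel_integral mu (unit_kernel Omega) v :> ('rV[R]_d -> R)) ->
  solves_limit sigma a u <->
  evolves (fun v => (2 * sigma) *: B v) u /\ N (u 0 - a) = 0.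
Proof.
move=> BE; rewrite /solves_limit L2dist_eq0_ae.
have E (f v : L2 mu) : f = (fun=> 2 * sigma * \int[lebesgue_rV R d]_(y in Omega) v y)
  %[ae mu] <->
    N (f - (2 * sigma) *: B v) = 0.
  rewrite L2dist_eq0_ae.
  have key : {ae mu, forall x, 2 * sigma * \int[lebesgue_rV R d]_(y in Omega) v y =
    ((2 * sigma) *: B v) x}.
    apply: ae_lebesgue_on => x Ox.
    by rewrite -[RHS]/(2 * sigma * B v x) BE unit_kernel_integralE.
  by split; apply: filterS2 key => x h1 /(_ I) h2 _; rewrite h2 h1.
by split=> -[h1 h2]; split => //; apply: ae_lebesgueS h1 => t h tT; apply/E; exact: h.
Qed.

(** The factor u x can be taken out of the inner integral for almost every x
    only, as that integral may diverge elsewhere. *)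
Lemma riesz_energyE (alpha : R) (B : L2 mu -> L2 mu) (v : L2 mu) :
  0 < d%:R - alpha -> d%:R - alpha < d%:R ->
  (forall v, B v = kernel_integral mu (riesz_kernel Omega (d%:R - alpha)) v
    :> ('rV[R]_d -> R)) ->
  riesz_energy alpha Omega v = - dot v (B v).
Proof.
move=> s0 sd BE; congr (- _); set s := d%:R - alpha in s0 sd BE *.
have [C C0 sk] := riesz_kernel_schur oOmega bOmega s0 sd.
pose k x y : R := v x * enorm (x - y) `^ (- s).
have mk : measurable_fun setT (fun p : 'rV[R]_d * 'rV[R]_d => k p.1 p.2).
  apply: measurable_funM; last exact: measurable_powRN_enorm.
  exact: (measurableT_comp (measurable_L2 v) measurable_fst).
pose g x : R := \int[lebesgue_rV R d]_(y in Omega) (v x * v y / enorm (x - y) `^ s).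
have gE : g = kernel_integral mu k v.
  apply/funext => x.
  transitivity (\int[lebesgue_rV R d]_(y in Omega) (k x y * v y)).
    by apply: eq_Rintegral => y _; rewrite /k powRN; ring.
  apply: Rintegral_lebesgue_on; apply: measurable_funM; last exact: measurable_L2.
  apply: measurable_funM; first exact: measurable_cst.
  exact: measurable_powRN_enorm_row.
have mg : measurable_fun setT g by rewrite gE; exact: measurable_kernel_integral.
rewrite -[LHS]/(\int[lebesgue_rV R d]_(x in Omega) g x) Rintegral_lebesgue_on//.
congr fine; apply: ae_eq_integral => //.
- exact/measurable_EFinP.
- by apply/measurable_EFinP; exact: measurable_funM.
have Oae : {ae mu, forall x, Omega x} by exact: ae_lebesgue_on.
have iae := kernel_integrable_ae v (ltW C0) sk.
apply: filterS2 Oae iae => x Ox ix _; congr EFin.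
rewrite BE /kernel_integral -RintegralZl// -Rintegral_lebesgue_on; last first.
  by apply: measurable_funM => //; have := measurable_int _ ix; move/measurable_EFinP.
apply: eq_Rintegral => y /set_mem Oy.
by rewrite /riesz_kernel !indic1// powRN; ring.
Qed.

Lemma riesz_energy_limitE (B : L2 mu -> L2 mu) (v : L2 mu) :
  (forall v, B v = kernel_integral mu (unit_kernel Omega) v :> ('rV[R]_d -> R)) ->
  riesz_energy_limit Omega v = - dot v (B v).
Proof.
move=> BE; congr (- _).
set c := \int[lebesgue_rV R d]_(x in Omega) v x.
have cE : c = \int[mu]_x v x by exact: Rintegral_lebesgue_on.
have iv : mu.-integrable setT (fun x => (v x)%:E).
  have [V V0 VE] := integral_cst_lebesgue_on oOmega bOmega.
  have [f fE] : exists f : L2 mu, f = cst 1 :> ('rV[R]_d -> R).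
    apply: L2_of_sqr_int; first exact: measurable_cst.
    rewrite (eq_integral (fun=> 1%:E)); first by rewrite VE ltry.
    by move=> x _; rewrite expr1n.
  have := integrable_L2_mul v f.
  by rewrite fE; under eq_fun do rewrite mulr1.
rewrite expr2 {1}cE -RintegralZr//.
congr fine; apply: ae_eq_integral => //.
- by apply/measurable_EFinP; exact: measurable_funM.
- by apply/measurable_EFinP; exact: measurable_funM.
apply: ae_lebesgue_on => x Ox _.
by rewrite BE unit_kernel_integralE.
Qed.

End riesz_evolution.


Theorem theorem4p5 (R : realType) (d : nat) (d_gt0 : (0 < d)%N)
    (Omega : set 'rV[R]_d) (oOmega : open Omega)
    (bOmega : bounded_set Omega) (lOmega : lipschitz_boundary Omega)
    (alpha : nat -> R) (alpha_in : forall n, 0 < alpha n < d%:R)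
    (alpha_cvg : alpha n @[n --> \oo] --> (d%:R : R))
    (u0_lim : L2 (lebesgue_on oOmega)) (u0 : nat -> L2 (lebesgue_on oOmega))
    (u0_cvg : L2norm (lebesgue_on oOmega) (u0 n - u0_lim) @[n --> \oo] --> (0 : R))
    (T : R) (T_gt0 : 0 < T) (sigma : R) (sigma_pm : sigma = 1 \/ sigma = -1) :
  (forall n : nat, exists u : H1 (lebesgue_on oOmega) T,
     solves_riesz sigma (alpha n) (u0 n) u /\
     forall v : H1 (lebesgue_on oOmega) T,
       solves_riesz sigma (alpha n) (u0 n) v -> H1_eq u v) /\
  (exists u : H1 (lebesgue_on oOmega) T,
     solves_limit sigma u0_lim u /\
     forall v : H1 (lebesgue_on oOmega) T,
       solves_limit sigma u0_lim v -> H1_eq u v) /\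
  (forall (u : nat -> H1 (lebesgue_on oOmega) T)
     (u_lim : H1 (lebesgue_on oOmega) T),
     (forall n, solves_riesz sigma (alpha n) (u0 n) (u n)) ->
     solves_limit sigma u0_lim u_lim ->
     H1_sqdist (u n) u_lim @[n --> \oo] --> (0%E : \bar R) /\
     forall t, t \in `[0, T] ->
       L2norm (lebesgue_on oOmega) (u n t - u_lim t) @[n --> \oo] --> (0 : R) /\
       riesz_energy (alpha n) Omega (u n t) @[n --> \oo] -->
         riesz_energy_limit Omega (u_lim t)).
Proof.
pose mu := lebesgue_on oOmega.
pose s n := d%:R - alpha n.
have s_gt0 n : 0 < s n by have /andP[_ ?] := alpha_in n; rewrite subr_gt0.
have s_ltd n : s n < d%:R by have /andP[? _] := alpha_in n; rewrite /s ltrBlDr ltrDl.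
have s_cvg : s n @[n --> \oo] --> (0 : R).
  by rewrite -(subrr (d%:R : R)); apply: cvgB => //; exact: cvg_cst.
have sig2 : `|2 * sigma| = 2.
  by case: sigma_pm => ->; rewrite ?mulrN mulr1 ?normrN ger0_norm.
have /choice[C_ CP] n : exists C, 0 < C /\ schur_kernel mu (riesz_kernel Omega (s n)) C.
  by have [C C0 sk] := riesz_kernel_schur oOmega bOmega (s_gt0 n) (s_ltd n); exists C.
have /choice[B_ BP] n := kernel_operator_exists (CP n).1 (CP n).2.
have [C C0 sk] := unit_kernel_schur oOmega bOmega.
have [B [BE Bb Bl]] := kernel_operator_exists C0 sk.
have BnE n : forall v, B_ n v = kernel_integral mu (riesz_kernel Omega (s n)) v
  :> ('rV[R]_d -> R).
  by have [] := BP n.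
pose A_ n (v : L2 mu) : L2 mu := (2 * sigma) *: B_ n v.
pose A (v : L2 mu) : L2 mu := (2 * sigma) *: B v.
have Rn n a (v : H1 mu T) : solves_riesz sigma (alpha n) a v <->
    evolves (A_ n) v /\ L2norm mu (v 0 - a) = 0.
  exact: solves_riesz_evolves (BnE n).
have Rl a (v : H1 mu T) : solves_limit sigma a v <->
    evolves A v /\ L2norm mu (v 0 - a) = 0.
  exact: solves_limit_evolves BE.
have wellposed (D : R) (M : L2 mu -> L2 mu) (a : L2 mu) : 0 < D ->
    (forall u : L2 mu, L2norm mu (M u) <= D * L2norm mu u) ->
    (forall (b : R) (u v : L2 mu), L2norm mu (M (b *: u + v) - (b *: M u + M v)) = 0) ->
    exists u : H1 mu T, (evolves (fun v => (2 * sigma) *: M v) u /\ L2norm mu (u 0 - a) = 0) /\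
      forall v : H1 mu T, evolves (fun v =>
        (2 * sigma) *: M v) v /\ L2norm mu (v 0 - a) = 0 -> H1_eq u v.
  move=> D0 Mb Ml.
  have D20 : 0 < `|2 * sigma| * D by rewrite sig2 mulr_gt0.
  have [U [U0 U1]] := linear_evolution_exists a (ltW D20)
    (scaled_bounded (2 * sigma) Mb) (scaled_linear (2 * sigma) Ml) T_gt0.
  have eU : evolves (fun v => (2 * sigma) *: M v) U.
    by exists set0; split => // t /= /not_implyP[tT]; apply => {}; exact: U1.
  exists U; split => // v [ev v0].
  exact: (evolves_unique T_gt0 D20 (scaled_lipschitz (2 * sigma) Mb Ml) eU ev U0 v0).
split.
  move=> n; have [_ Mb Ml] := BP n.
  have [U [U1 U2]] := wellposed _ _ (u0 n) (CP n).1 Mb Ml.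
  by exists U; split => [|v]; [exact/Rn|move/Rn; exact: U2].
split.
  have [U [U1 U2]] := wellposed _ _ u0_lim C0 Bb Bl.
  by exists U; split => [|v]; [exact/Rl|move/Rl; exact: U2].
move=> u v un vl.
have {}un n := (Rn n (u0 n) (u n)).1 (un n).
have {vl} [ev v0] := (Rl u0_lim v).1 vl.
have [s0 [K [s00 K0 kcvg]]] := riesz_kernel_cvg oOmega d_gt0 bOmega.
pose e n : R := 2 * (s n * K).
have e_ge0 n : 0 <= e n by rewrite !mulr_ge0// ltW.
have e_cvg : e n @[n --> \oo] --> (0 : R).
  rewrite [X in _ --> X](_ : 0 = 2 * (0 * K)); last by ring.
  apply: cvgM; first exact: cvg_cst.
  by apply: cvgM => //; exact: cvg_cst.
(* a common bound for the operators with s n <= s0 and for their limit *)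
pose D : R := C + s0 * K.
have D0 : 0 < D by rewrite addr_gt0// mulr_gt0.
have D20 : 0 < `|2 * sigma| * D by rewrite sig2 mulr_gt0.
have s_near : \forall n \near \oo, s n <= s0.
  move/cvgrPdist_le : s_cvg => /(_ s0 s00); apply: filterS => n.
  by rewrite sub0r normrN ger0_norm// ltW.
have Bdist n : s n <= s0 -> forall w : L2 mu,
  L2norm mu (B_ n w - B w) <= s n * K * L2norm mu w.
  move=> sn; apply: (kernel_operator_dist (CP n).1 C0 _ (CP n).2 sk _ (BnE n) BE).
    by rewrite mulr_gt0.
  exact: kcvg.
have ABn : \forall n \near \oo, lipschitz_op (A_ n) (`|2 * sigma| * D) /\
    forall w : L2 mu, L2norm mu (A_ n w - A w) <= e n * L2norm mu w.
  apply: filterS s_near => n sn; have [_ _ Ml] := BP n; split.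
    apply: scaled_lipschitz => // w.
    have h1 := L2normD (B_ n w - B w) (B w); rewrite subrK in h1.
    have h2 := Bdist n sn w; have h3 := Bb w.
    have h4 : s n * K * L2norm mu w <= s0 * K * L2norm mu w.
      by rewrite ler_wpM2r ?L2norm_ge0// ler_wpM2r// ltW.
    apply: (le_trans h1); rewrite /D mulrDl addrC; apply: lerD; first exact: h3.
    exact: le_trans h2 h4.
  move=> w; rewrite /A_ /A -scalerBr L2normZ sig2 /e -mulrA ler_wpM2l//.
  exact: Bdist.
have Al : lipschitz_op A (`|2 * sigma| * D).
  apply: scaled_lipschitz => // w; rewrite (le_trans (Bb w))//.
  by rewrite ler_wpM2r ?L2norm_ge0// lerDl mulr_ge0// ltW.
have icvg : L2norm mu (u n 0 - v 0) @[n --> \oo] --> (0 : R).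
  apply: (@squeeze_cvgr _ _ _ _ (cst 0) (fun n => L2norm mu (u0 n - u0_lim))) => //.
    apply: nearW => n; apply/andP; split; first exact: L2norm_ge0.
    have [_ i0] := un n.
    rewrite (le_trans (L2dist_le0 _ i0))// L2normBC [leRHS]L2normBC.
    exact: L2dist_le0.
  exact: cvg_cst.
have [r [r0 rP sq]] := evolves_cvg T_gt0 D20 Al e_ge0 e_cvg ABn (fun n => (un n).1) ev icvg.
split; first exact: sq.
move=> t tT.
have ucvg : L2norm mu (u n t - v t) @[n --> \oo] --> (0 : R).
  apply: (@squeeze_cvgr _ _ _ _ (cst 0) r) => //; last exact: cvg_cst.
  apply: filterS rP => n /(_ t tT) [h _].
  by apply/andP; split; [exact: L2norm_ge0|exact: h].
split; first exact: ucvg.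
rewrite (riesz_energy_limitE bOmega (v t) BE).
have -> : (fun n => riesz_energy (alpha n) Omega (u n t)) =
    (fun n => - dot (u n t) (B_ n (u n t))).
  by apply/funext => n; exact: (riesz_energyE bOmega (u n t) (s_gt0 n) (s_ltd n) (BnE n)).
apply: cvgN; apply: dot_cvg => //.
apply: (@squeeze_cvgr _ _ _ _ (cst 0) r) => //; last exact: cvg_cst.
apply: filterS rP => n /(_ t tT) [_].
rewrite /A_ /A -scalerBr L2normZ sig2 => h.
apply/andP; split; first exact: L2norm_ge0.
apply: le_trans h; rewrite ler_peMl ?L2norm_ge0//.
by rewrite ler1n.
Qed.
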